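(* Let $X$ and $Y$ be computable Polish spaces and let $f:X\to Y$ be a (total, single-valued) function. Then the following are equivalent: (1) $f\leq_{\mathrm W}\mathsf{C}_{\mathbb{N}^{\mathbb{N}}}$; (2) $f$ is effectively Borel measurable.
   Context: Baire space is $\mathbb{N}^{\mathbb{N}}$, with its usual product topology and a fixed computable bijective pairing $\langle\cdot,\cdot\rangle$ on it. Computability of partial functions $F:\subseteq\mathbb{N}^{\mathbb{N}}\to\mathbb{N}^{\mathbb{N}}$ is meant via (type-2) Turing machines. A representation of a set $X$ is a surjective partial function $\delta:\subseteq\mathbb{N}^{\mathbb{N}}\to X$; $(X,\delta)$ is a represented space. $f:\subseteq X\rightrightarrows Y$ denotes a partial multi-valued function ($f(x)\neq\emptyset$ for $x\in\mathrm{dom}(f)$). A realizer of $f:\subseteq(X,\delta_X)\rightrightarrows(Y,\delta_Y)$, written $F\vdash f$, is a single-valued $F:\subseteq\mathbb{N}^{\mathbb{N}}\to\mathbb{N}^{\mathbb{N}}$ with $\delta_Y F(p)\in f\delta_X(p)$ for all $p\in\mathrm{dom}(f\delta_X)$. Weihrauch reducibility $f\leq_{\mathrm W}g$ means: there are computable $K,H:\subseteq\mathbb{N}^{\mathbb{N}}\to\mathbb{N}^{\mathbb{N}}$ such that $p\mapsto K\langle p,GH(p)\rangle$ is a realizer of $f$ for every $G\vdash g$. Sierpiński space $\mathbb{S}=\{0,1\}$ has topology $\{\emptyset,\{1\},\{0,1\}\}$ and representation $\delta_{\mathbb{S}}(p)=1\iff(\exists n)\,p(n)=0$. For a represented space $(X,\delta)$,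 a set $U\subseteq X$ is open if its characteristic function $\chi_U:X\to\mathbb{S}$ has a continuous realizer, and closed sets are the complements of open sets. $\mathcal{A}_-(X)$ is the set of closed subsets of $X$ with the representation $\psi_-^X$: a name of $A$ is a name of $\chi_{X\setminus A}$ in the canonical function space representation $[\delta\to\delta_{\mathbb{S}}]$ (a name $nq$, $n\in\mathbb N$, $q\in\mathbb{N}^{\mathbb{N}}$, names $\chi$ iff $r\mapsto\Phi_n\langle q,r\rangle$ is a realizer of $\chi$, where $\Phi_n$ is the $n$-th computable partial function on $\mathbb{N}^{\mathbb{N}}$). The computable points of $\mathcal{A}_-(X)$ (those with a computable name) are the co-c.e. closed sets. Closed choice is $\mathsf{C}_X:\subseteq\mathcal{A}_-(X)\rightrightarrows X,\ A\mapsto A$ with domain the non-empty closed sets. Baire space is represented by the identity. A computable metric space $(X,d,\alpha)$ is a separable metric space with a numbering $\alpha:\mathbb{N}\to X$ of a countable dense subset such that $(i,j)\mapsto d(\alpha(i),\alpha(j))$ is computable; it is represented by its Cauchy representation ($p$ names $\lim_i\alpha(p(i))$ provided $d(\alpha(p(i)),\alpha(p(j)))<2^{-j}$ for all $i>j$). A computable Polish space is a complete computable metric space. Products carry the canonical product structure. A subset $A\subseteq X$ of a computable Polish space $X$ is an effective $\Sigma^1_1$-set if there is a co-c.e. closed $B\subseteq X\times\mathbb{N}^{\mathbb{N}}$ with $x\in A\iff(\exists p\in\mathbb{N}^{\mathbb{N}})\,(x,p)\in B$. A function $f:X\to Y$ between computable Polish spaces is effectively Borel measurable if its graph is an effective $\Sigma^1_1$-subset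 of $X\times Y$. *)

(* Defs.v *)
From HB Require Import structures.
From mathcomp Require Import all_boot all_order all_algebra.
From mathcomp Require Import all_classical all_reals all_analysis.
Import Order.TTheory GRing.Theory Num.Theory.

Set Implicit Arguments.
Unset Strict Implicit.
Unset Printing Implicit Defensive.

Local Open Scope classical_set_scope.
Local Open Scope nat_scope.

(* Type-2 Turing machines are given by flowcharts, as in Weihrauch's
   "Computable Analysis".  They have a one-way read-only input tape and a
   one-way write-only output tape, both carrying words over the alphabet bool,
   and two-way infinite work tapes.  Work tapes and work tape symbols are
   numbered by nat; a program mentions only finitely many of each, so that the
   number of tapes and the alphabet of a given machine are finite.  The blank
   is 0. *)

(* The two halves of a tape, read away from the head; the scanned cell is the
   first one on the right.  Cells beyond the end of a list are blank. *)
Definition tape : Type := (seq nat * seq nat)%type.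

Definition scan (tp : tape) : nat := head 0 tp.2.

Definition write_cell (a : nat) (tp : tape) : tape := (tp.1, a :: behead tp.2).

Definition move_head (right : bool) (tp : tape) : tape :=
  if right then (head 0 tp.2 :: tp.1, behead tp.2)
  else (behead tp.1, head 0 tp.1 :: tp.2).

Inductive instr :=
  | Halt
  | MoveIn
  | TestIn of nat              (* TestIn l: go to l if the input cell is true *)
  | Out of bool
  | Move of nat & bool         (* tape, rightwards? *)
  | Write of nat & nat         (* tape, symbol *)
  | Test of nat & nat & nat.   (* Test k a l: go to l if tape k scans a *)

Record config := Config {
  pc : nat;
  input_pos : nat;
  work : nat -> tape;
  output : seq bool }.

(* A program counter outside the program halts the machine. *)
Definition step (M : seq instr) (w : nat -> bool) (c : config) : config :=
  let: Config l i T o := c in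
  match nth Halt M l with
  | Halt => c
  | MoveIn => Config l.+1 i.+1 T o
  | TestIn l' => Config (if w i then l' else l.+1) i T o
  | Out b => Config l.+1 i T (rcons o b)
  | Move k d => Config l.+1 i [eta T with k |-> move_head d (T k)] o
  | Write k a => Config l.+1 i [eta T with k |-> write_cell a (T k)] o
  | Test k a l' => Config (if scan (T k) == a then l' else l.+1) i T o
  end.

Definition run (M : seq instr) (w : nat -> bool) (t : nat) : config :=
  iter t (step M w) (Config 0 0 (fun=> ([::], [::])) [::]).

(* Goedel numbering of programs: every program has a number, and numbers that
   code no instruction stand for Halt. *)
Definition instr_of_nat (n : nat) : instr :=
  match CodeSeq.decode n with
  | [:: 1] => MoveIn
  | [:: 2; l] => TestIn l
  | [:: 3; b] => Out (0 < b)
  | [:: 4; k; d] => Move k (0 < d)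
  | [:: 5; k; a] => Write k a
  | [:: 6; k; a; l] => Test k a l
  | _ => Halt
  end.

Definition machine (n : nat) : seq instr :=
  map instr_of_nat (CodeSeq.decode n).

(* Multi-valued partial functions from X to Y are maps X -> set Y, with
   domain the points of nonempty value; partial functions are the
   single-valued ones. *)

Definition baire : Type := nat -> nat.

Definition single_valued (A B : Type) (F : A -> set B) : Prop :=
  forall a b b', F a b -> F a b' -> b = b'.

(* The infinite word 1^(p 0) 0 1^(p 1) 0 1^(p 2) 0 ..., with 1 for true. *)
Definition unary_word (p : baire) (k : nat) : bool :=
  nth false (flatten [seq rcons (nseq (p i) true) false | i <- iota 0 k.+1]) k.

(* Phi n is the n-th computable partial function: Phi n p q holds when machine
   n, on the word of p, writes the whole infinite word of q. *)
Definition Phi (n : nat) (p : baire) : set baire :=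
  [set q | forall k, exists t,
     take k (output (run (machine n) (unary_word p) t))
       = mkseq (unary_word q) k].

(* As usual, the machine may also produce output outside the domain of F. *)
Definition computable (F : baire -> set baire) : Prop :=
  single_valued F /\ exists n, forall p q, F p q -> Phi n p q.

Definition computable_point (p : baire) : Prop := computable (fun=> [set p]).

Definition continuous_pfun (F : baire -> set baire) : Prop :=
  single_valued F /\
  forall V : set {ptws nat -> nat}, open V ->
    exists2 U : set {ptws nat -> nat}, open U &
      forall p q, F p q -> (U p <-> V q).

Definition bpair (p q : baire) : baire :=
  fun n => if odd n then q n./2 else p n./2.

(* d p x says that p is a name of x. *)
Definition representation (X : Type) : Type := baire -> set X.

Definition baire_rep : representation baire := fun p => [set p].

Definition nat_rep : representation nat := fun p => [set p 0].

(* Sierpinski space has the points false (for 0) and true (for 1). *)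
Definition sierpinski_rep : representation bool :=
  fun p => [set b | b = true <-> exists n, p n = 0].

Definition prod_rep (X Y : Type) (dX : representation X)
    (dY : representation Y) : representation (X * Y)%type :=
  fun r => [set xy | exists p q, [/\ r = bpair p q, dX p xy.1 & dY q xy.2]].

Definition realizes (X Y : Type) (dX : representation X)
    (dY : representation Y) (F : baire -> set baire) (f : X -> set Y) : Prop :=
  single_valued F /\
  forall p x, dX p x -> f x !=set0 ->
    exists q y, [/\ F p q, dY q y & f x y].

Definition mfun_of (X Y : Type) (f : X -> Y) : X -> set Y := fun x => [set f x].

Definition computable_fun (X Y : Type) (dX : representation X)
    (dY : representation Y) (f : X -> Y) : Prop :=
  exists2 F, computable F & realizes dX dY F (mfun_of f).

Definition weihrauch_le (X Y Z W : Type)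
    (dX : representation X) (dY : representation Y) (f : X -> set Y)
    (dZ : representation Z) (dW : representation W) (g : Z -> set W) : Prop :=
  exists K H : baire -> set baire, [/\ computable K, computable H &
    forall G, realizes dZ dW G g ->
      realizes dX dY
        (fun p => [set r | exists h s, [/\ H p h, G h s & K (bpair p s) r]]) f].

(* The canonical representation of the total functions with a continuous
   realizer; a name is a number n followed by a sequence q. *)
Definition function_rep (X Y : Type) (dX : representation X)
    (dY : representation Y) : representation (X -> Y) :=
  fun nq => [set f | realizes dX dY
    (fun r => Phi (nq 0) (bpair (fun k => nq k.+1) r)) (mfun_of f)].

Definition char_fun (X : Type) (U : set X) : X -> bool := fun x => x \in U.

Definition rep_open (X : Type) (dX : representation X) (U : set X) : Prop :=
  exists2 F, continuous_pfun F &
    realizes dX sierpinski_rep F (mfun_of (char_fun U)).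

Definition rep_closed (X : Type) (dX : representation X) (A : set X) : Prop :=
  rep_open dX (~` A).

Definition closed_rep (X : Type) (dX : representation X) :
    representation (set X) :=
  fun p => [set A | function_rep dX sierpinski_rep p (char_fun (~` A))].

Definition co_ce_closed (X : Type) (dX : representation X) (A : set X) : Prop :=
  exists2 p, computable_point p & closed_rep dX p A.

Definition closed_choice (X : Type) (dX : representation X) : set X -> set X :=
  fun A => [set x | rep_closed dX A /\ A x].

Definition cauchy_rep (R : realType) (X : metricType R) (alpha : nat -> X) :
    representation X :=
  fun p => [set x |
    (forall i j, j < i ->
       (mdist (alpha (p i)) (alpha (p j)) < 2%:R^-1 ^+ j)%R) /\
    (fun i => alpha (p i)) @ \oo --> x].

(* An enumeration of the rationals, (a - b) / (c + 1). *)
Definition rational_of_nat (R : realType) (n : nat) : R :=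
  let s := CodeSeq.decode n in
  (((nth 0 s 0)%:R - (nth 0 s 1)%:R) / (nth 0 s 2).+1%:R)%R.

(* R^o is R with the distance |x - y|. *)
Definition real_rep (R : realType) : representation R :=
  @cauchy_rep R R^o (@rational_of_nat R).

Record computable_polish (R : realType) (X : metricType R) (alpha : nat -> X) :
    Prop := ComputablePolish {
  alpha_dense : dense (range alpha);
  dist_computable :
    computable_fun (prod_rep nat_rep nat_rep) (@real_rep R)
      (fun ij => mdist (alpha ij.1) (alpha ij.2));
  metric_complete :
    forall u : nat -> X, cauchy (u @ \oo) -> exists x : X, u @ \oo --> x }.

Definition effective_Sigma11 (X : Type) (dX : representation X) (A : set X) :
    Prop :=
  exists2 B : set (X * baire), co_ce_closed (prod_rep dX baire_rep) B &
    forall x, A x <-> exists p, B (x, p).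

Definition effectively_Borel (X Y : Type) (dX : representation X)
    (dY : representation Y) (f : X -> Y) : Prop :=
  effective_Sigma11 (prod_rep dX dY) [set xy | xy.2 = f xy.1].

(* Main.v *)
Require Import Defs.
From HB Require Import structures.
From mathcomp Require Import all_boot all_order all_algebra.
From mathcomp Require Import all_classical all_reals all_analysis.
From mathcomp Require Import zify ring lra.

Set Implicit Arguments.
Unset Strict Implicit.
Unset Printing Implicit Defensive.

Local Open Scope nat_scope.

(** Both sides of the equivalence say that [y = f x] is witnessed by a point of
    Baire space subject to a closed condition; they differ in how this
    condition is presented.

    Let [K] and [H] reduce [f] to closed choice.  Then [y = f x] if and only if
    there are a name [p] of [x], a name [q] of [y], and sequences [h] and [r]
    such that [h] is the value of [H] at [p], [r] belongs to the closed set
    with name [h], and [q] is the value of [K] at the pair of [p] and [r].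
    Every [r] in the closed set can be used, since some realizer of closed
    choice returns it ([favour], [reduction_answers]).  The violation of each
    of these conditions is semidecidable.  This is so even for the values of
    [K] and [H]: the graph of a partial computable function need not be closed,
    but the arguments lie in the domain, and there a sequence that is never
    contradicted by the output is the value ([conflictP]).  This gives
    [borel_of_weihrauch].

    Conversely, let [B] be the closed set that witnesses the graph.  From a name
    of [x] one computes a name of the closed set of all pairs of sequences [q]
    and [r] such that [q] converges fast enough and [((x, lim q), r)] is in
    [B].  It is nonempty because [f x] exists, and closed choice returns a pair
    whose first component is a name of [f x] up to a shift.  This gives
    [weihrauch_of_borel].  The shift is needed because names obey strict
    inequalities, which are not a closed condition; the non-strict ones are,
    and they become strict when the first term is dropped ([shift_strict]).

    The rest provides the machines.  Tapes are used as counters, loop programs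
    on counters compute the primitive recursive functions ([calc], [pr]), and a
    primitive recursive transition function is turned into a machine that reads
    and writes sequences ([mealy_machine], [computable_search]).  Conversely,
    the first [t] steps of machine [n] are a primitive recursive function of
    [n], [t] and the first [t] input values ([simE]).  The number [n] has to be
    a variable here, because the name [h] of a closed set contains the number
    of a machine.  Semidecidable predicates on Baire space are then those with
    a primitive recursive test on finite prefixes ([semidec]), and they are
    closed under the operations from which the conditions above are built. *)

(** * Register programs on flowchart machines *)

Definition store : Type := nat -> nat.

Definition state : Type := (store * seq bool)%type.

Definition upd (s : store) (x v : nat) : store :=
  fun z => if z == x then v else s z.

(** A register with value [n] is a tape with a block of [n] ones immediately to
    the left of the head.  The scanned cell is left free, which gives every
    tape a cell for the writing of a symbol that a jump can rely on.  Blanks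
    may be listed explicitly behind the block, as happens when the head moves
    to the left of an empty block and back. *)
Definition holds (tp : tape) (n : nat) : Prop :=
  forall i, nth 0 tp.1 i = (i < n).

Definition at_state (c : config) (l i : nat) (st : state) : Prop :=
  [/\ pc c = l, input_pos c = i, output c = st.2 &
    forall k, holds (work c k) (st.1 k)].

Definition embedded (M : seq instr) (l : nat) (code : seq instr) : Prop :=
  forall j, j < size code -> nth Halt M (l + j) = nth Halt code j.

(** A program is a function of its address because jumps are absolute. *)
Definition prog (F : state -> state) : Prop :=
  exists (len : nat) (code : nat -> seq instr), forall l,
    size (code l) = len /\
    forall M w c i st, embedded M l (code l) -> at_state c l i st ->
      exists t, at_state (iter t (step M w) c) (l + len) i (F st).

Lemma embedded_cat M l c1 c2 :
  embedded M l (c1 ++ c2) ->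
  embedded M l c1 /\ embedded M (l + size c1) c2.
Proof.
move=> h; split=> j hj.
- by rewrite h ?size_cat ?ltn_addr // nth_cat hj.
- rewrite -addnA h ?size_cat ?ltn_add2l // nth_cat ltnNge leq_addr /=.
  by rewrite addKn.
Qed.

Lemma upd_same s x v : upd s x v x = v.
Proof. by rewrite /upd eqxx. Qed.

Lemma upd_other s x v z : z != x -> upd s x v z = s z.
Proof. by rewrite /upd => /negbTE->. Qed.

Lemma at_state_ext c l l' i st st' :
  l = l' -> st.2 = st'.2 -> st.1 =1 st'.1 -> at_state c l i st ->
  at_state c l' i st'.
Proof.
move=> <- h2 h1 [? ? ho h]; split=> //; first by rewrite ho.
by move=> k; rewrite -h1.
Qed.

Lemma prog_id : prog id.
Proof.
exists 0, (fun=> [::]) => l; split=> // M w c i st _ h.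
by exists 0; rewrite addn0.
Qed.

Lemma prog_seq F G : prog F -> prog G -> prog (G \o F).
Proof.
move=> [n [c hF]] [n' [c' hG]].
exists (n + n'), (fun l => c l ++ c' (l + n)) => l.
have [sF hF'] := hF l; have [sG hG'] := hG (l + n).
split; first by rewrite size_cat sF sG.
move=> M w d i st /embedded_cat[e1]; rewrite sF => e2 hd.
have [t ht] := hF' M w d i st e1 hd.
have [t' ht'] := hG' M w _ i _ e2 ht.
by exists (t' + t); rewrite iterD addnA.
Qed.

Lemma prog_out b : prog (fun st => (st.1, rcons st.2 b)).
Proof.
exists 1, (fun=> [:: Out b]) => l; split=> // M w [pc0 i0 T o] i [s o'] e.
case=> /= -> -> -> hT; exists 1 => /=.
have := e 0 isT; rewrite addn0 /= => ->.
by split=> //=; rewrite addn1.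
Qed.

Definition incr (x : nat) (st : state) : state :=
  (upd st.1 x (st.1 x).+1, st.2).

Definition decr (x : nat) (st : state) : state :=
  (upd st.1 x (st.1 x).-1, st.2).

Lemma holds_left tp n :
  holds tp n.+1 -> holds (move_head false tp) n /\ scan (move_head false tp) = 1.
Proof.
move=> h; split; first by move=> i; rewrite /= nth_behead h.
by rewrite /scan /= -nth0 h.
Qed.

Lemma holds_bounce tp :
  holds tp 0 -> scan (move_head false tp) = 0 /\
  holds (move_head true (move_head false tp)) 0.
Proof.
move=> h; split; first by rewrite /scan /= -nth0 h.
by case=> [|i] /=; rewrite ?nth_behead ?h // -nth0 h.
Qed.

Lemma prog_inc x : prog (incr x).
Proof.
exists 2, (fun=> [:: Write x 1; Move x true]) => l; split=> //.
move=> M w [pc0 i0 T o] i [s o'] e [/= -> -> -> hT]; exists 2 => /=.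
have := e 0 isT; rewrite addn0 /= => ->.
have := e 1 isT; rewrite addn1 /= => ->.
split=> //=; first by rewrite addn2.
move=> k; rewrite /upd eqxx; case: eqVneq => // _.
by case=> [|j] //=; rewrite hT.
Qed.

Lemma prog_dec x : prog (decr x).
Proof.
exists 3, (fun l => [:: Move x false; Test x 1 (l + 3); Move x true]) => l.
split=> // M w [pc0 i0 T o] i [s o'] e [/= -> -> -> hT].
have e0 := e 0 isT; have e1 := e 1 isT; have e2 := e 2 isT.
rewrite addn0 /= in e0; rewrite addn1 /= in e1; rewrite addn2 /= in e2.
case hx: (s x) => [|n].
- exists 3; rewrite /= /step e0 /= e1 /= eqxx.
  have := hT x; rewrite hx => /holds_bounce[-> hb] /=; rewrite e2.
  split=> //=; first by rewrite addn3.
  move=> k; rewrite hx /upd /= eqxx; case: eqVneq => // _.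
- exists 2; rewrite /= /step e0 /= e1 /= eqxx.
  have := hT x; rewrite hx => /holds_left[hb ->] /=.
  split=> //= k; rewrite hx /upd /=; case: eqVneq => // _; exact: hb.
Qed.

Definition loopr (x : nat) (F : state -> state) (st : state) : state :=
  iter (st.1 x) (F \o decr x) st.

(** The program is the loop [while x <> 0 do x := x - 1; F], and the number of
    rounds is known in advance because [F] keeps [x].  The scanned cell is
    cleared before each unconditional jump, which makes the test succeed. *)
Lemma prog_loop x F :
  prog F -> (forall st, (F st).1 x = st.1 x) -> prog (loopr x F).
Proof.
move=> [n [c hF]] hx.
pose code l := [:: Move x false; Test x 1 (l + 5); Move x true; Write x 0;
  Test x 0 (l + (n + 7))] ++ c (l + 5) ++ [:: Write x 0; Test x 0 l].
exists (n + 7), code => l; have [sF hF'] := hF (l + 5).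
split; first by rewrite /code !size_cat sF /= addnC -addnA.
move=> M w d i st /embedded_cat[e1 /embedded_cat[/= e2 e3]].
rewrite sF -addnA in e3.
have e10 := e1 0 isT; have e11 := e1 1 isT; have e12 := e1 2 isT.
have e13 := e1 3 isT; have e14 := e1 4 isT.
have e30 := e3 0 isT; have e31 := e3 1 isT.
rewrite addn0 in e10; rewrite addn0 in e30.
rewrite /= in e10 e11 e12 e13 e14 e30 e31.
move: {2}(st.1 x) (erefl (st.1 x)) => k.
elim: k d st => [|k IH] [pc0 i0 T o] [s o'] /= hk [/= -> -> -> hT].
- exists 5; rewrite /loopr /= hk /= /step.
  rewrite e10 /= -addn1 e11 /= eqxx.
  have := hT x; rewrite hk => /holds_bounce[-> hb] /=.
  rewrite -addn1 -addnA e12 /= -addn1 -addnA e13 /= -addn1 -addnA e14 /=.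
  rewrite eqxx /=; split=> //= j /=.
  case: eqVneq => [->|//]; rewrite hk; exact: hb.
- have hT' := hT x; rewrite hk in hT'; have [hb hs] := holds_left hT'.
  have h1 : at_state (iter 2 (step M w) (Config l i T o')) (l + 5) i
     (decr x (s, o')).
    rewrite /= /step e10 /= -addn1 e11 /= eqxx hs /=; split=> //= j.
    rewrite hk /upd /=; case: eqVneq => // _; exact: hb.
  have [t1 h2] := hF' M w _ i _ e2 h1.
  have hFx : (F (decr x (s, o'))).1 x = k by rewrite hx /= upd_same hk.
  have [t2 h3] : exists t, at_state (iter t (step M w)
      (iter 2 (step M w) (iter t1 (step M w)
        (iter 2 (step M w) (Config l i T o'))))) (l + (n + 7)) i
        (loopr x F (F (decr x (s, o')))).
    apply: IH => //.
    case: (iter t1 _ _) h2 => pc1 i1 T1 o1 [/= -> -> -> hT1].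
    rewrite -addnA.
    rewrite /= /step e30 /= -addn1 e31 /= eqxx /=; split=> //= j.
    by case: eqVneq => [->|//]; exact: hT1.
  exists (t2 + (2 + (t1 + 2))); rewrite !iterD.
  have -> // : loopr x F (s, o') = loopr x F (F (decr x (s, o'))).
  by rewrite /loopr hFx /= hk iterSr.
Qed.

(** * Arithmetic with registers *)

(** A relation between the stores before and after the run, rather than a
    function, leaves open what happens to scratch registers. *)
Definition silent (Q : store -> store -> Prop) : Prop :=
  exists2 F, prog F & forall st, (F st).2 = st.2 /\ Q st.1 (F st).1.

Lemma silent_weaken (Q Q' : store -> store -> Prop) :
  silent Q -> (forall s s', Q s s' -> Q' s s') -> silent Q'.
Proof.
by move=> [F pF hF] h; exists F => // st; have [? /h] := hF st.
Qed.

Lemma silent_seq (Q1 Q2 Q : store -> store -> Prop) :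
  silent Q1 -> silent Q2 ->
  (forall s s' s'', Q1 s s' -> Q2 s' s'' -> Q s s'') -> silent Q.
Proof.
move=> [F pF hF] [G pG hG] h; exists (G \o F); first exact: prog_seq.
move=> st /=; have [w1 q1] := hF st; have [w2 q2] := hG (F st).
by split; [rewrite w2|apply: h q1 q2].
Qed.

Lemma silent_comp (f g : store -> store) :
  silent (fun s s' => s' = f s) -> silent (fun s s' => s' = g s) ->
  silent (fun s s' => s' = g (f s)).
Proof. by move=> hf hg; apply: silent_seq hf hg _ => s _ _ -> ->. Qed.

Lemma silent_inc x : silent (fun s s' => s' = upd s x (s x).+1).
Proof. by exists (incr x); first exact: prog_inc. Qed.

Lemma silent_dec x : silent (fun s s' => s' = upd s x (s x).-1).
Proof. by exists (decr x); first exact: prog_dec. Qed.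

(** The invariant [I] is indexed by the number of rounds that remain. *)
Lemma silent_loop x (B : store -> store -> Prop)
    (I : store -> nat -> store -> Prop) (Q : store -> store -> Prop) :
  silent B -> (forall s s', B s s' -> s' x = s x) ->
  (forall s, I s (s x) s) ->
  (forall s0 k s s', I s0 k.+1 s -> s x = k.+1 -> B (upd s x k) s' ->
     I s0 k s') ->
  (forall s s', I s 0 s' -> s' x = 0 -> Q s s') ->
  silent Q.
Proof.
move=> [F pF hF] hx h0 hS hQ; exists (loopr x F).
  by apply: prog_loop => // st; have [_ /hx] := hF st.
move=> st; rewrite /loopr.
have : forall n st', st'.1 x = n -> I st.1 n st'.1 ->
    let st'' := iter n (F \o decr x) st' in
    [/\ st''.2 = st'.2, st''.1 x = 0 & I st.1 0 st''.1].
  elim=> [|n IH] [s' o'] hn hI //; move: hn; rewrite /= => hn.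
  rewrite -[F _]/(iter n.+1 (F \o decr x) (s', o')) iterSr /=.
  have [/= w1 b1] := hF (decr x (s', o')).
  rewrite hn /= in b1.
  have hx' : (F (decr x (s', o'))).1 x = n by rewrite (hx _ _ b1) upd_same.
  by have [-> ? ?] := IH _ hx' (hS _ _ _ _ hI hn b1).
move=> /(_ _ st erefl (h0 _)) [w1 x0 i0]; split=> //; exact: hQ.
Qed.

(** Splits on the equality of register numbers; arithmetic closes the impossible
    cases. *)
Ltac regs := rewrite /upd /=; repeat (match goal with
  |- context[?a == ?b] => case: (eqVneq a b) => ?; [try subst|] end; rewrite //=);
  try congruence; try lia.

Lemma silent_move (x y : nat) : x != y ->
  silent (fun s s' => s' = upd (upd s y (s y + s x)) x 0).
Proof.
move=> xy.
apply: (@silent_loop x _ (fun s0 k s =>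
  s = upd (upd s0 y (s0 y + (s0 x - k))) x k /\ k <= s0 x) _ (silent_inc y)).
- by move=> s s' ->; rewrite upd_other.
- by move=> s; split=> //; apply/funext => z; regs.
- move=> s0 k s s' [-> hk] _ ->; split; last exact: ltnW.
  by apply/funext => z; regs.
- by move=> s s' [-> _] _; rewrite subn0.
Qed.

Lemma silent_clear x : silent (fun s s' => s' = upd s x 0).
Proof.
apply: (@silent_loop x (fun s s' => s' = s) (fun s0 k s => s = upd s0 x k)).
- by exists id => //; exact: prog_id.
- by move=> s s' ->.
- by move=> s; apply/funext => z; regs.
- by move=> s0 k s s' -> _ ->; apply/funext => z; regs.
- by [].
Qed.

(** A loop destroys its counter, so [x] is restored from the scratch register
    [t]. *)
Lemma silent_copy (x y t : nat) : x != y -> x != t -> y != t ->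
  silent (fun s s' => s' = upd (upd s y (s x)) t 0).
Proof.
move=> xy xt yt.
have two : silent (fun s s' => s' = upd (upd s y (s y).+1) t (s t).+1).
  apply: silent_seq (silent_inc y) (silent_inc t) _ => s _ _ -> ->.
  by rewrite [upd s y _ t]upd_other 1?eq_sym.
have loop : silent (fun s s' =>
    s' = upd (upd (upd s y (s y + s x)) t (s t + s x)) x 0).
  apply: (@silent_loop x _ (fun s0 k s => s = upd (upd (upd s0 y
    (s0 y + (s0 x - k))) t (s0 t + (s0 x - k))) x k /\ k <= s0 x) _ two).
  - by move=> s s' ->; rewrite !upd_other.
  - by move=> s; split=> //; apply/funext => z; regs.
  - move=> s0 k s s' [-> hk] _ ->; split; last exact: ltnW.
    rewrite !(@upd_other _ x) 1?eq_sym // !upd_same (@upd_other _ t _ y) //.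
    by rewrite upd_same; apply/funext => z; regs.
  - by move=> s s' [-> _] _; rewrite subn0.
have clear2 : silent (fun s s' => s' = upd (upd s y 0) t 0).
  by apply: silent_seq (silent_clear y) (silent_clear t) _ => s _ _ -> ->.
have tx : t != x by rewrite eq_sym.
have h := silent_comp (silent_comp clear2 loop) (silent_move tx).
by apply: silent_weaken h _ => s _ ->; apply/funext => z; regs.
Qed.

Lemma silent_double (y t : nat) : y != t ->
  silent (fun s s' => s' = upd (upd s y (s y).*2) t 0).
Proof.
move=> yt; have ty : t != y by rewrite eq_sym.
have two := silent_comp (silent_inc t) (silent_inc t).
have loop : silent (fun s s' => s' = upd (upd s t (s t + (s y).*2)) y 0).
  apply: (@silent_loop y _ (fun s0 k s => s = upd (upd s0 t
    (s0 t + (s0 y - k).*2)) y k /\ k <= s0 y) _ two).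
  - by move=> s s' ->; rewrite !upd_other.
  - by move=> s; split=> //; apply/funext => z; regs.
  - move=> s0 k s s' [-> hk] _ ->; split; last exact: ltnW.
    by apply/funext => z; regs.
  - by move=> s s' [-> _] _; rewrite subn0.
have h := silent_comp (silent_comp (silent_clear t) loop) (silent_move ty).
by apply: silent_weaken h _ => s _ ->; apply/funext => z; regs.
Qed.

(** The code of a list from its head and the code of its tail; pairs and lists
    thus share one coding. *)
Definition cpair (a b : nat) : nat := 2 ^ a * b.*2.+1.

(** The registers below [N] are kept: programs use the registers from [N] on as
    a stack. *)
Definition keeps (N : nat) (s s' : store) : Prop := forall z, z < N -> s' z = s z.

(** The odd factor is built first and then doubled as often as the first
    component says. *)
Lemma silent_pair N :
  silent (fun s s' => s' N = cpair (s N.+1) (s N.+2) /\ keeps N s s').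
Proof.
have NN (i : nat) : N != N + i.+1 by lia.
have d1 : N.+2 != N by lia.
have d2 : N != N.+3 by lia.
have h1 := silent_comp (silent_comp (silent_comp (silent_clear N)
  (silent_move d1)) (silent_double d2)) (silent_inc N).
have h2 : silent (fun s s' => s' N = 2 ^ s N.+1 * s N /\ keeps N s s').
  apply: (@silent_loop N.+1 _ (fun s0 k s => [/\ s N = 2 ^ (s0 N.+1 - k) * s0 N,
    k <= s0 N.+1 & keeps N s0 s]) _ (silent_double d2)).
  - by move=> s s' ->; regs.
  - by move=> s; rewrite subnn expn0 mul1n.
  - move=> s0 k s s' [h hk hN] _ ->; split; last 1 first.
    + by move=> z hz; rewrite -hN //; regs.
    + regs; rewrite h (_ : s0 N.+1 - k = (s0 N.+1 - k.+1).+1); last lia.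
      by rewrite expnS -mul2n mulnA.
    + exact: ltnW.
  - by move=> s s' [h _ hN] _; rewrite subn0 in h.
apply: silent_seq h1 h2 _ => s s' s'' -> [-> hN]; split.
  by rewrite /cpair; regs.
by move=> z hz; rewrite hN //; regs.
Qed.

(** Evaluates updates at known registers without case splits, whose number
    would be exponential in the depth of nested updates. *)
Ltac reg_at :=
  repeat first [rewrite upd_same | rewrite upd_other; last lia]; try lia.

Definition hd (n : nat) : nat := head 0 (CodeSeq.decode n).

Definition tl (n : nat) : nat := CodeSeq.code (behead (CodeSeq.decode n)).

Lemma decode_cpair a b : CodeSeq.decode (cpair a b) = a :: CodeSeq.decode b.
Proof. by rewrite -(CodeSeq.codeK (a :: _)) /= CodeSeq.decodeK. Qed.

Lemma hd_cpair a b : hd (cpair a b) = a.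
Proof. by rewrite /hd decode_cpair. Qed.

Lemma tl_cpair a b : tl (cpair a b) = b.
Proof. by rewrite /tl decode_cpair /= CodeSeq.decodeK. Qed.

(** A bit is flipped in each round, and the quotient grows when the bit drops to
    zero. *)
Lemma silent_halve N : silent (fun s s' =>
  s' = upd (upd (upd (upd s N.+2 (s N.+1)./2) N.+3 (odd (s N.+1))) N.+4 0)
         N.+1 0).
Proof.
have swap : silent (fun s s' =>
    s' = upd (upd (upd s N.+4 (s N.+4 - s N.+3)) N.+2 (s N.+2 + s N.+3)) N.+3 0).
  have two := silent_comp (silent_dec N.+4) (silent_inc N.+2).
  apply: (@silent_loop N.+3 _ (fun s0 k s => s = upd (upd (upd s0
    N.+4 (s0 N.+4 - (s0 N.+3 - k))) N.+2 (s0 N.+2 + (s0 N.+3 - k))) N.+3 k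
    /\ k <= s0 N.+3) _ two).
  - by move=> s s' ->; regs.
  - by move=> s; split=> //; apply/funext => z; regs.
  - move=> s0 k s s' [-> hk] _ ->; split; last exact: ltnW.
    by apply/funext => z; regs.
  - by move=> s s' [-> _] _; rewrite subn0.
have d : N.+4 != N.+3 by lia.
have flip : silent (fun s s' => s' = upd (upd (upd s N.+2 (s N.+2 + s N.+3))
    N.+3 (1 - s N.+3)) N.+4 0).
  have h := silent_comp (silent_comp (silent_comp (silent_clear N.+4)
    (silent_inc N.+4)) swap) (silent_move d).
  by apply: silent_weaken h _ => s _ ->; apply/funext => z; regs.
have loop : silent (fun s s' => s N.+2 = 0 -> s N.+3 = 0 -> s N.+4 = 0 ->
    s' = upd (upd (upd (upd s N.+2 (s N.+1)./2) N.+3 (odd (s N.+1))) N.+4 0)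
         N.+1 0).
  apply: (@silent_loop N.+1 _ (fun s0 k s =>
    s0 N.+2 = 0 -> s0 N.+3 = 0 -> s0 N.+4 = 0 ->
    s = upd (upd (upd (upd s0 N.+2 (s0 N.+1 - k)./2)
    N.+3 (odd (s0 N.+1 - k))) N.+4 0) N.+1 k /\ k <= s0 N.+1) _ flip).
  - by move=> s s' ->; regs.
  - move=> s h1 h2 h3; split=> //; rewrite subnn.
    by apply/funext => z; regs.
  - move=> s0 k s s' h _ -> h1 h2 h3; have [-> hk] := h h1 h2 h3.
    split; last exact: ltnW.
    have e : s0 N.+1 - k = (s0 N.+1 - k.+1).+1 by lia.
    by apply/funext => z; regs; rewrite e /= ?uphalf_half; case: odd.
  - by move=> s s' h _ h1 h2 h3; have [-> _] := h h1 h2 h3; rewrite subn0.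
have h := silent_comp (silent_comp (silent_clear N.+2) (silent_clear N.+3))
  (silent_clear N.+4).
apply: silent_seq h loop _ => s s' s'' -> -> //; try by regs.
by apply/funext => z; regs.
Qed.

(** The exponent of 2 in [n > 0] is found by halving as long as possible; [n]
    rounds are enough because [n < 2 ^ n]. *)
Lemma silent_split N :
  silent (fun s s' => [/\ s' N = hd (s N), s' N.+1 = tl (s N) & keeps N s s']).
Proof.
have d1 : N.+2 != N + 6 by lia.
have unhalve : silent (fun s s' => s N.+3 <= 1 ->
    [/\ s' N.+2 = (if s N.+3 == 1 then (s N.+2).*2.+1 else s N.+2),
      s' N.+4 = s N.+4 - s N.+3, s' (N + 5) = s (N + 5) &
      keeps N.+2 s s']).
  have body := silent_comp (silent_comp (silent_dec N.+4) (silent_double d1))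
    (silent_inc N.+2).
  apply: (@silent_loop N.+3 _ (fun s0 k s => s0 N.+3 <= 1 -> k <= s0 N.+3 /\
     [/\ s N.+2 = (if s0 N.+3 - k == 1 then (s0 N.+2).*2.+1 else s0 N.+2),
      s N.+4 = s0 N.+4 - (s0 N.+3 - k), s (N + 5) = s0 (N + 5) &
      keeps N.+2 s0 s]) _ body).
  - by move=> s s' ->; regs.
  - by move=> s _; rewrite subnn subn0.
  - move=> s0 k s s' h _ -> h1; have [h2 [h3 h4 h5 h6]] := h h1.
    have k0 : k = 0 by lia.
    have e : s0 N.+3 = 1 by lia.
    rewrite e k0 /= in h3 h4 h2 *; split=> //; split.
    + by regs; rewrite h3.
    + by regs; rewrite h4.
    + by regs.
    + by move=> z hz; rewrite -h6 //; regs.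
  - by move=> s s' h _ h1; have [_] := h h1; rewrite !subn0.
have d2 : N.+4 != N + 5 by lia.
have d3 : N.+2 != N.+1 by lia.
have round : silent (fun s s' =>
    [/\ s' N.+1 = if odd (s N.+1) then s N.+1 else (s N.+1)./2,
      s' (N + 5) = s (N + 5) + ~~ odd (s N.+1) & keeps N.+1 s s']).
  have h1 := silent_comp (silent_comp (silent_halve N) (silent_clear N.+4))
    (silent_inc N.+4).
  have h2 := silent_comp (silent_comp (silent_move d2) (silent_clear N.+1))
    (silent_move d3).
  have h3 : silent (fun s s' =>
      [/\ s' N.+2 = if odd (s N.+1) then s N.+1 else (s N.+1)./2,
      s' N.+4 = ~~ odd (s N.+1), s' (N + 5) = s (N + 5) & keeps N.+1 s s']).
    have h1' : silent (fun s s' => [/\ s' N.+2 = (s N.+1)./2,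
        s' N.+3 = odd (s N.+1), s' N.+4 = 1, s' (N + 5) = s (N + 5) &
        keeps N.+1 s s']).
      apply: silent_weaken h1 _ => s s' ->.
      by split=> [||||z hz]; regs.
    apply: silent_seq h1' unhalve _ => s s' s'' [e2 e3 e4 e5 k1] h.
    move: h; rewrite e2 e3 e4 e5 => -[|-> -> -> h]; first by case: odd.
    split=> //.
    - by have := odd_double_half (s N.+1); case: odd => //= <-.
    - by case: odd.
    - by move=> z hz; rewrite h ?k1 //; lia.
  apply: silent_seq h3 h2 _ => s s' s'' [h2' h4 h5 hN] ->; split.
  - by regs.
  - by regs; rewrite h5 h4.
  - by move=> z hz; rewrite -hN //; regs.
have loop : silent (fun s s' => s N = s N.+1 -> s (N + 5) = 0 ->
    [/\ s' N = 0, 2 ^ s' (N + 5) * s' N.+1 = s N, 0 < s N -> odd (s' N.+1),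
      s' (N + 5) <= s N & keeps N s s']).
  apply: (@silent_loop N _ (fun s0 k s => s0 N = s0 N.+1 -> s0 (N + 5) = 0 ->
    [/\ 2 ^ s (N + 5) * s N.+1 = s0 N, k <= s0 N,
      odd (s N.+1) || (s (N + 5) == s0 N - k), s (N + 5) <= s0 N - k &
      keeps N s0 s]) _ round).
  - by move=> s s' [_ _ h]; apply: h.
  - by move=> s h1 h2; rewrite h1 h2 subnn eqxx orbT mul1n; split.
  - move=> s0 k s s' h _ [h1 h2 h3] e1 e2; have [h4 h5 h6 h8 h7] := h e1 e2.
    have u1 : upd s N k N.+1 = s N.+1 by regs.
    have u2 : upd s N k (N + 5) = s (N + 5) by regs.
    rewrite u1 in h1; rewrite u1 u2 in h2; split.
    + rewrite h1 h2 -h4; case: ifP => [_|/negbT ev]; first by rewrite addn0.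
      rewrite addn1 expnS -mulnA mulnCA; congr (_ * _).
      by rewrite mul2n even_halfK // (negbTE ev).
    + exact: ltnW.
    + rewrite h1 h2; case: ifP => [->//|ev]; rewrite ev /= in h6.
      by rewrite (eqP h6); apply/orP; right; apply/eqP => /=; lia.
    + by rewrite h2; case: (odd _) => /=; lia.
    + by move=> z hz; rewrite h3 ?ltnS 1?ltnW // -h7 //; regs.
  - move=> s s' h h0 e1 e2; have [h1 _ h2 h4 h3] := h e1 e2; rewrite subn0 in h4.
    split=> // p; case/orP: h2 => // /eqP h2; rewrite subn0 in h2.
    rewrite h2 in h1; have lt := ltn_expl (s N) (ltnSn 1).
    have p' : 0 < s' N.+1 by move: p; rewrite -h1 muln_gt0 => /andP[].
    have := leq_mul (leqnn (2 ^ s N)) p'; rewrite muln1 h1 => le.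
    by move: (leq_trans lt le); rewrite ltnn.
have c1 : N != N.+1 by lia.
have c2 : N != N.+2 by lia.
have c3 : N.+1 != N.+2 by lia.
have c4 : N + 5 != N by lia.
have h1 := silent_comp (silent_clear (N + 5)) (silent_copy c1 c2 c3).
have h2 := silent_comp (silent_comp (silent_halve N) (silent_move d3))
  (silent_move c4).
have h3 : silent (fun s s' => [/\ 2 ^ s' (N + 5) * s' N.+1 = s N,
    s' (N + 5) <= s N, s' N = 0, 0 < s N -> odd (s' N.+1) & keeps N s s']).
  apply: silent_seq h1 loop _ => s s' s'' -> h.
  case: h => [||h4 h5 h6 h8 h7]; try by regs.
  have e : upd (upd (upd s (N + 5) 0) N.+1 (upd s (N + 5) 0 N)) N.+2 0 N = s N.
    by regs.
  rewrite e in h5 h6 h8; split=> //.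
  by move=> z hz; rewrite h7 //; regs.
apply: silent_seq h3 h2 _ => s s' s'' [h4 h8 h5 h6 h7] ->.
have [e1 e2] : s' (N + 5) = hd (s N) /\ (s' N.+1)./2 = tl (s N).
  case: (posnP (s N)) h4 h6 h8 => [->|p] h4 h6 h8.
    move/eqP: h4; rewrite muln_eq0 expn_eq0 /= => /eqP ->.
    by move: h8; rewrite leqn0 => /eqP ->.
  rewrite -h4 -(odd_double_half (s' N.+1)) (h6 isT) add1n.
  by rewrite -[2 ^ _ * _]/(cpair _ _) hd_cpair tl_cpair /= uphalf_double.
split.
- by reg_at.
- by reg_at.
- by move=> z hz; rewrite -h7 //; reg_at.
Qed.

(** * Functions on numbers computed by register programs *)

(** Argument and result are both on top of the stack. *)
Definition calc (f : nat -> nat) : Prop :=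
  forall N, silent (fun s s' => s' N = f (s N) /\ keeps N s s').

Lemma calc_id : calc id.
Proof. by move=> N; exists id => //; exact: prog_id. Qed.

Lemma calc_comp f g : calc f -> calc g -> calc (g \o f).
Proof.
move=> hf hg N; apply: silent_seq (hf N) (hg N) _ => s s' s'' [e k] [e' k'].
by split; [rewrite e' e|move=> z hz; rewrite k' ?k].
Qed.

Lemma calc_zero : calc (fun=> 0).
Proof.
move=> N; apply: silent_weaken (silent_clear N) _ => s _ ->.
by split=> [|z hz]; regs.
Qed.

Lemma calc_succ : calc succn.
Proof.
move=> N; apply: silent_weaken (silent_inc N) _ => s _ ->.
by split=> [|z hz]; regs.
Qed.

Lemma calc_hd : calc hd.
Proof.
by move=> N; apply: silent_weaken (silent_split N) _ => s s' [? _ ?].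
Qed.

Lemma calc_tl : calc tl.
Proof.
move=> N; have d : N.+1 != N by lia.
have h := silent_comp (silent_clear N) (silent_move d).
apply: silent_seq (silent_split N) h _ => s s' s'' [_ e k] ->; split.
  by regs; rewrite e.
by move=> z hz; rewrite -k //; regs.
Qed.

(** [f] and [g] run on copies of the argument above it, [g] also above the value
    of [f], which protects what is still needed. *)
Lemma calc_pair f g : calc f -> calc g -> calc (fun x => cpair (f x) (g x)).
Proof.
move=> hf hg N.
have d1 : N != N.+1 by lia.
have d2 : N != N.+2 by lia.
have d3 : N.+1 != N.+2 by lia.
have d4 : N != N.+3 by lia.
have d5 : N.+2 != N.+3 by lia.
have h1 : silent (fun s s' => s' N = s N /\ s' N.+1 = f (s N) /\ keeps N s s').
  apply: silent_seq (silent_copy d1 d2 d3) (hf N.+1) _ => s s' s'' -> [e k].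
  split; first by rewrite k //; regs.
  split; first by rewrite e; congr f; regs.
  by move=> z hz; rewrite k; [regs|lia].
have h2 : silent (fun s s' => [/\ s' N.+1 = s N.+1, s' N.+2 = g (s N) &
    keeps N s s']).
  apply: silent_seq (silent_copy d2 d4 d5) (hg N.+2) _ => s s' s'' -> [e k].
  split; first by rewrite k //; regs.
  - by rewrite e; congr g; regs.
  - by move=> z hz; rewrite k; [regs|lia].
have h3 : silent (fun s s' => [/\ s' N.+1 = f (s N), s' N.+2 = g (s N) &
    keeps N s s']).
  apply: silent_seq h1 h2 _ => s s' s'' [e1 [e2 k1]] [e3 e4 k2].
  split; [by rewrite e3|by rewrite e4 e1|by move=> z hz; rewrite k2 ?k1].
apply: silent_seq h3 (silent_pair N) _ => s s' s'' [e1 e2 k1] [e3 k2].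
by split; [rewrite e3 e1 e2|move=> z hz; rewrite k2 ?k1].
Qed.

(** The counter stays below the register on which [h] is iterated. *)
Lemma calc_iter h : calc h -> calc (fun x => iter (hd x) h (tl x)).
Proof.
move=> hh N.
have loop : silent (fun s s' => [/\ s' N = 0, s' N.+1 = iter (s N) h (s N.+1) &
    keeps N s s']).
  apply: (@silent_loop N _ (fun s0 k s => [/\ s N.+1 = iter (s0 N - k) h (s0 N.+1),
    k <= s0 N & keeps N s0 s]) _ (hh N.+1)).
  - by move=> s s' [_ k]; rewrite k.
  - by move=> s; rewrite subnn.
  - move=> s0 k s s' [e1 hk k1] _ [e2 k2]; split.
    + rewrite e2 (_ : s0 N - k = (s0 N - k.+1).+1); last lia.
      by rewrite iterS -e1; congr h; regs.
    + exact: ltnW.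
    + by move=> z hz; rewrite k2 ?ltnS 1?ltnW // -k1 //; regs.
  - by move=> s s' [e _ k] e0; rewrite subn0 in e.
have d : N.+1 != N by lia.
have h2 : silent (fun s s' => s' N = iter (s N) h (s N.+1) /\ keeps N s s').
  apply: silent_seq loop (silent_move d) _ => s s' s'' [e1 e2 k1] ->.
  by split=> [|z hz]; [regs|rewrite -k1 //; regs].
apply: silent_seq (silent_split N) h2 _ => s s' s'' [e1 e2 k1] [e3 k2].
by split; [rewrite e3 e1 e2|move=> z hz; rewrite k2 ?k1].
Qed.

(** * Unary words *)

Definition unary (x : nat) : seq bool := rcons (nseq x true) false.

Definition unaries (xs : seq nat) : seq bool := flatten (map unary xs).

Lemma unaries_cat xs ys : unaries (xs ++ ys) = unaries xs ++ unaries ys.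
Proof. by rewrite /unaries map_cat flatten_cat. Qed.

Lemma unaries_rcons xs x : unaries (rcons xs x) = unaries xs ++ unary x.
Proof. by rewrite -cats1 unaries_cat /unaries /= cats0. Qed.

Lemma size_unaries xs : size xs <= size (unaries xs).
Proof.
elim: xs => //= x xs IH; rewrite -add1n [unaries _]/(unary x ++ unaries xs).
by rewrite size_cat size_rcons leq_add.
Qed.

Lemma mkseq_add (T : Type) (p : nat -> T) s t :
  mkseq p (s + t) = mkseq p s ++ mkseq (fun i => p (s + i)) t.
Proof.
rewrite /mkseq iotaD map_cat add0n; congr (_ ++ _).
by rewrite -[in iota s _](addn0 s) iotaDl -map_comp.
Qed.

Lemma nth_unaries_mkseq p s t k :
  k < size (unaries (mkseq p s)) -> k < size (unaries (mkseq p t)) ->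
  nth false (unaries (mkseq p s)) k = nth false (unaries (mkseq p t)) k.
Proof.
wlog le : s t / s <= t => [h hs ht|].
  by case: (leqP s t) => [/h|/ltnW/h ->] //; apply.
move=> hs _; rewrite -(subnKC le) mkseq_add unaries_cat nth_cat hs.
by [].
Qed.

(** The definition of [unary_word] takes a prefix whose length depends on the
    position; any prefix that is long enough gives the same symbol. *)
Lemma unary_wordE p s k : k < size (unaries (mkseq p s)) ->
  unary_word p k = nth false (unaries (mkseq p s)) k.
Proof.
move=> hk; rewrite -(@nth_unaries_mkseq p k.+1) //.
  by rewrite /unary_word /unaries -map_comp.
by apply: leq_trans (size_unaries _); rewrite size_mkseq.
Qed.

Lemma unary_word_block p s j : j <= p s ->
  unary_word p (size (unaries (mkseq p s)) + j) = (j < p s).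
Proof.
move=> hj; rewrite (@unary_wordE _ s.+1) mkseqS unaries_rcons; last first.
  by rewrite size_cat ltn_add2l size_rcons size_nseq.
rewrite nth_cat ltnNge leq_addr /= addKn nth_rcons size_nseq nth_nseq.
by case: ltngtP hj.
Qed.

(** * Transducers *)

(** The transducer with transition function [g] maps a state [z] and an input
    value [x] to the code of the next state, a flag, and a value that is written
    when the flag is 1. *)
Fixpoint mealy_state (g : nat -> nat) (p : baire) (s : nat) : nat :=
  if s is s'.+1 then hd (g (cpair (mealy_state g p s') (p s'))) else 0.

Definition mealy_out (g : nat -> nat) (p : baire) (s : nat) : seq nat :=
  let v := tl (g (cpair (mealy_state g p s) (p s))) in nseq (hd v) (tl v).

Lemma prog_emit : exists2 F, prog F & forall s o, s 1 <= 1 ->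
  F (s, o) = (upd (upd s 2 (if s 1 == 1 then 0 else s 2)) 1 0,
    o ++ unaries (nseq (s 1) (s 2))).
Proof.
have ptrue := prog_loop (prog_out true) (fun st => erefl (st.1 2)).
set Ft := loopr _ _ in ptrue.
have Ftrue s o : Ft (s, o) = (upd s 2 0, o ++ nseq (s 2) true).
  rewrite /Ft /loopr /=.
  suff h n : s 2 = n -> iter n ((fun st : state => (st.1, rcons st.2 true))
      \o decr 2) (s, o) = (upd s 2 0, o ++ nseq n true) by exact: h.
  elim: n s o => [|n IH] s o hn.
    by rewrite /= cats0; congr pair; apply/funext => z; regs.
  rewrite iterSr /= {1}/decr /= IH /=; last by rewrite upd_same hn.
  by rewrite cat_rcons; congr pair; apply/funext => z; regs.
have pbody := prog_seq ptrue (prog_out false).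
have h1 : forall st, (((fun st : state => (st.1, rcons st.2 false)) \o Ft) st).1 1
    = st.1 1.
  by move=> [s o]; rewrite /= Ftrue /=; regs.
exists (loopr 1 ((fun st : state => (st.1, rcons st.2 false)) \o Ft)).
  exact: prog_loop.
move=> s o; rewrite /loopr /=; case e: (s 1) => [|[|//]] _ /=.
  by rewrite cats0; congr pair; apply/funext => z; regs.
rewrite /decr /= Ftrue /= e /unaries /= cats0 -rcons_cat.
by congr pair; apply/funext => z; regs.
Qed.

(** Register 1 holds the state and register 2 the input value; the pair is
    formed in register 0. *)
Lemma prog_transition g : calc g -> (forall a b, hd (tl (g (cpair a b))) <= 1) ->
  exists2 F, prog F & forall s o, let n := g (cpair (s 1) (s 2)) in
    [/\ (F (s, o)).1 1 = hd n, (F (s, o)).1 2 = 0 &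
      (F (s, o)).2 = o ++ unaries (nseq (hd (tl n)) (tl (tl n)))].
Proof.
move=> cg g1.
have h1 : silent (fun s s' => s' 0 = g (cpair (s 1) (s 2))).
  by apply: silent_seq (silent_pair 0) (cg 0) _ => s s' s'' [e _] [-> _]; rewrite e.
have h2 : silent (fun s s' => let n := g (cpair (s 1) (s 2)) in
    [/\ s' 0 = hd n, s' 1 = hd (tl n) & s' 2 = tl (tl n)]).
  have h3 : silent (fun s s' => let n := g (cpair (s 1) (s 2)) in
      s' 0 = hd n /\ s' 1 = tl n).
    by apply: silent_seq h1 (silent_split 0) _ => s s' s'' -> [].
  apply: silent_seq h3 (silent_split 1) _ => s s' s'' /= [e1 <-] [e3 e4 k].
  by rewrite k.
have [E pE hE] := prog_emit.
have [A pA hA] := h2.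
have d : 0 != 1 by [].
have [B pB hB] := silent_comp (silent_comp (silent_clear 1) (silent_move d))
  (silent_clear 2).
exists (B \o (E \o A)); first by apply: prog_seq pB; exact: prog_seq.
move=> s o n; have [] := hA (s, o); rewrite /=; case: (A (s, o)) => s' o' /= -> [].
rewrite -/n => e0 e1 e2.
have [] := hB (E (s', o)); rewrite hE /= ?e1 ?(g1 (s 1) (s 2)) // => -> ->; split.
- by regs.
- by regs.
- by rewrite e2.
Qed.

(** Register 2 counts the ones of a block of the input.  The first four
    instructions consume the separator and leave the reader for address 9; the
    others count a one and jump back.  The free cell of tape 0 serves for the
    jumps. *)
Definition reader : seq instr :=
  [:: TestIn 4; MoveIn; Write 0 0; Test 0 0 9;
      Write 2 1; Move 2 true; MoveIn; Write 0 0; Test 0 0 0].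

Lemma reader_run M w c i s o x :
  embedded M 0 reader -> at_state c 0 i (s, o) ->
  (forall j, j <= x -> w (i + j) = (j < x)) ->
  exists t, at_state (iter t (step M w) c) 9 (i + x).+1 (upd s 2 (s 2 + x), o).
Proof.
move=> hM; have e j := hM j; rewrite /= in e.
have e0 := e 0 isT; have e1 := e 1 isT; have e2 := e 2 isT.
have e3 := e 3 isT; have e4 := e 4 isT; have e5 := e 5 isT.
have e6 := e 6 isT; have e7 := e 7 isT; have e8 := e 8 isT.
rewrite /= ?add0n in e0 e1 e2 e3 e4 e5 e6 e7 e8.
elim: x c i s => [|x IH] [pc0 i0 T o0] i s /= [/= -> -> -> hT] hw.
  have := hw 0 isT; rewrite addn0 ltnn => w0.
  exists 4; rewrite /= /step e0 w0 /= e1 /= e2 /= e3 /=.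
  rewrite /scan /=; split; rewrite ?addn0 //=.
  move=> k; rewrite (_ : upd s 2 _ k = s k); last by regs.
  by case: eqVneq => [->|//]; exact: hT.
have := hw 0 isT; rewrite addn0 ltn0Sn => w0.
have h1 : at_state (iter 6 (step M w) (Config 0 i T o)) 0 i.+1
    (upd s 2 (s 2).+1, o).
  rewrite /= /step e0 w0 /= e4 /= e5 /= e6 /= e7 /= e8 /=.
  rewrite /scan /=; split=> //= k.
  have [->|k0] := eqVneq k 0; first exact: hT.
  rewrite /upd; case: eqVneq => [_|_]; last exact: hT.
  by case=> [|j] //=; rewrite hT.
have [|t ht] := IH _ _ _ h1.
  by move=> j hj; rewrite addSnnS hw.
exists (t + 6); rewrite iterD -addSnnS; apply: at_state_ext ht => // z.
by regs.
Qed.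

(** Reader and transition are repeated forever.  Between rounds the machine is
    at address 0 with the state in register 1 and register 2 cleared. *)
Lemma mealy_program g : calc g -> (forall a b, hd (tl (g (cpair a b))) <= 1) ->
  exists M, forall p s, exists t,
    output (run M (unary_word p) t) =
      unaries (flatten (mkseq (mealy_out g p) s)).
Proof.
move=> cg g1; have [F [len [code hF]] hFE] := prog_transition cg g1.
have [sF hF'] := hF 9.
have [M [M1 M2 M3]] : exists M, [/\ embedded M 0 reader, embedded M 9 (code 9) &
    embedded M (9 + len) [:: Write 0 0; Test 0 0 0]].
  exists (reader ++ code 9 ++ [:: Write 0 0; Test 0 0 0]).
  have : embedded (reader ++ code 9 ++ [:: Write 0 0; Test 0 0 0]) 0
    (reader ++ code 9 ++ [:: Write 0 0; Test 0 0 0]) by move=> j _; rewrite add0n.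
  by move=> /embedded_cat[h1 /embedded_cat[h2]]; rewrite sF.
exists M => p s.
suff [t [st ht [h1 h2 h3]]] : exists t, exists2 st,
    at_state (run M (unary_word p) t) 0 (size (unaries (mkseq p s))) st &
    [/\ st.1 1 = mealy_state g p s, st.1 2 = 0 &
      st.2 = unaries (flatten (mkseq (mealy_out g p) s))].
  by exists t; rewrite -h3; case: ht.
elim: s => [|s [t [[s0 o0] ht [h1 h2 h3]]]].
  exists 0, (fun=> 0, [::]); split=> //= k i.
  by rewrite nth_nil.
rewrite [_.1 1]/= in h1; rewrite [_.1 2]/= in h2; rewrite [_.2]/= in h3.
have [t1 ht1] := reader_run M1 ht (fun j => @unary_word_block p s j).
have [t2 ht2] := hF' M (unary_word p) _ _ _ M2 ht1.
have := hFE (upd s0 2 (s0 2 + p s)) o0.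
case: (F _) ht2 => s1 o1 ht2; rewrite upd_same (@upd_other _ 2 _ 1) // h1 h2 add0n.
case=> f1 f2 f3.
exists (2 + (t2 + (t1 + t))), (s1, o1); last first.
  rewrite mkseqS -cats1 flatten_cat unaries_cat -h3 /= cats0.
  by split.
rewrite /run !iterD; rewrite /run in ht2.
have e0 := M3 0 isT; have e1 := M3 1 isT; rewrite addn0 in e0; rewrite addn1 in e1.
case: (iter t2 _ _) ht2 => pc0 i0 T o2 [/= -> -> -> hT].
rewrite /= /step e0 /= e1 /= /scan /=; split=> //.
  by rewrite mkseqS unaries_rcons size_cat size_rcons size_nseq -addnS.
by move=> k /=; case: (eqVneq k 0) => [->|_]; exact: hT.
Qed.

Definition instr_code (a : instr) : seq nat :=
  match a with
  | Halt => [::]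
  | MoveIn => [:: 1]
  | TestIn l => [:: 2; l]
  | Out b => [:: 3; b : nat]
  | Move k d => [:: 4; k; d : nat]
  | Write k a => [:: 5; k; a]
  | Test k a l => [:: 6; k; a; l]
  end.

Lemma machine_surj M : exists n, machine n = M.
Proof.
exists (CodeSeq.code [seq CodeSeq.code (instr_code a) | a <- M]).
rewrite /machine CodeSeq.codeK -map_comp -[RHS]map_id.
apply: eq_map => a; rewrite /= /instr_of_nat CodeSeq.codeK.
case: a => [||l|b|k d|k a|k a l] //=.
- by case: b.
- by case: d.
Qed.

Lemma mealy_machine g : calc g -> (forall a b, hd (tl (g (cpair a b))) <= 1) ->
  exists n, forall p s, exists t,
    output (run (machine n) (unary_word p) t) =
      unaries (flatten (mkseq (mealy_out g p) s)).
Proof.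
move=> cg g1; have [M hM] := mealy_program cg g1.
by have [n hn] := machine_surj M; exists n; rewrite hn.
Qed.

(** * Primitive recursive functions on coded types *)

Class coded (A : Type) := cd : A -> nat.

#[export] Instance coded_nat : coded nat := id.
#[export] Instance coded_bool : coded bool := nat_of_bool.
#[export] Instance coded_unit : coded unit := fun=> 0.
#[export] Instance coded_prod (A B : Type) (cA : coded A) (cB : coded B) :
  coded (A * B) := fun x => cpair (cd x.1) (cd x.2).
#[export] Instance coded_seq (A : Type) (cA : coded A) : coded (seq A) :=
  foldr (fun x n => cpair (cd x) n) 0.

(** Codes need not be injective: a function is in the class when some computed
    function on codes tracks it. *)
Definition pr (A B : Type) (cA : coded A) (cB : coded B) (f : A -> B) : Prop :=
  exists2 g, calc g & forall a, cd (f a) = g (cd a).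
Arguments pr {A B cA cB} f.

Section Pr.
Context (A : Type) (cA : coded A).

Lemma pr_ext (B : Type) (cB : coded B) (f g : A -> B) : pr f -> f =1 g -> pr g.
Proof. by move=> [h ch e] fg; exists h => // a; rewrite -fg. Qed.

Lemma pr_id : pr (fun a : A => a).
Proof. by exists id => //; exact: calc_id. Qed.

Lemma pr_comp (B C : Type) (cB : coded B) (cC : coded C) (f : A -> B)
    (g : B -> C) : pr g -> pr f -> pr (fun a => g (f a)).
Proof.
move=> [k ck ek] [h ch eh]; exists (k \o h); first exact: calc_comp.
by move=> a /=; rewrite ek eh.
Qed.

Lemma calc_const c : calc (fun=> c).
Proof.
elim: c => [|c IH]; first exact: calc_zero.
exact: calc_comp IH calc_succ.
Qed.

Lemma pr_const (B : Type) (cB : coded B) (b : B) : pr (fun _ : A => b).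
Proof. by exists (fun=> cd b) => //; exact: calc_const. Qed.

Lemma pr_pair (B C : Type) (cB : coded B) (cC : coded C) (f : A -> B)
    (g : A -> C) : pr f -> pr g -> pr (fun a => (f a, g a)).
Proof.
move=> [h ch eh] [k ck ek]; exists (fun n => cpair (h n) (k n)).
  exact: calc_pair.
by move=> a; rewrite {1}/cd /coded_prod /= eh ek.
Qed.

Lemma pr_fst (B C : Type) (cB : coded B) (cC : coded C) (f : A -> B * C) :
  pr f -> pr (fun a => (f a).1).
Proof.
move=> [h ch eh]; exists (hd \o h); first exact: calc_comp calc_hd.
by move=> a /=; rewrite -eh hd_cpair.
Qed.

Lemma pr_snd (B C : Type) (cB : coded B) (cC : coded C) (f : A -> B * C) :
  pr f -> pr (fun a => (f a).2).
Proof.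
move=> [h ch eh]; exists (tl \o h); first exact: calc_comp calc_tl.
by move=> a /=; rewrite -eh tl_cpair.
Qed.

(** The argument is carried along as first component of the iterated pair. *)
Lemma pr_iter (B : Type) (cB : coded B) (n : A -> nat) (s : A -> B)
    (h : A * B -> B) :
  pr n -> pr s -> pr h -> pr (fun a => iter (n a) (fun b => h (a, b)) (s a)).
Proof.
move=> [gn cn en] [gs cs es] [gh ch eh].
pose step z := cpair (hd z) (gh z).
have cstep : calc step by apply: calc_pair => //; exact: calc_hd.
exists (fun x => tl (iter (hd (cpair (gn x) (cpair x (gs x)))) step
  (tl (cpair (gn x) (cpair x (gs x)))))).
  apply: (calc_comp _ calc_tl).
  apply: (@calc_comp _ (fun x => iter (hd x) step (tl x)) _ (calc_iter cstep)).
  by do 2!apply: calc_pair => //; exact: calc_id.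
move=> a; rewrite hd_cpair tl_cpair -en.
have E (k : nat) : iter k step (cpair (cd a) (gs (cd a))) =
    cpair (cd a) (cd (iter k (fun b => h (a, b)) (s a))).
  elim: k => [|k IH]; first by rewrite /= es.
  by rewrite iterS IH /step hd_cpair [in RHS]iterS eh.
by rewrite E tl_cpair.
Qed.

Lemma pr_if (B : Type) (cB : coded B) (b : A -> bool) (f g : A -> B) :
  pr b -> pr f -> pr g -> pr (fun a => if b a then f a else g a).
Proof.
move=> pb pf pg.
(* A conditional is an iteration of at most one round. *)
have pb' : pr (fun a => b a : nat) by case: pb => k ck ek; exists k.
have pf' : pr (fun p : A * B => f p.1).
  by case: pf => k ck ek; exists (k \o hd); [exact: calc_comp calc_hd ck|
    move=> p /=; rewrite /cd /coded_prod hd_cpair; exact: ek].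
by apply: pr_ext (pr_iter pb' pg pf') _ => a; case: (b a).
Qed.

Lemma pr_succ (f : A -> nat) : pr f -> pr (fun a => (f a).+1).
Proof.
by move=> [h ch eh]; exists (succn \o h);
  [exact: calc_comp calc_succ|move=> a /=; rewrite -eh].
Qed.

End Pr.

Lemma pr_natP (f : nat -> nat) : pr f -> calc f.
Proof. by move=> [h ch eh]; have -> : f = h by apply/funext. Qed.

Lemma pr_pred A (cA : coded A) (f : A -> nat) : pr f -> pr (fun a => (f a).-1).
Proof.
move=> pf.
have h : pr (fun a => (iter (f a) (fun p => (p.1.+1, p.1)) (0, 0)).2).
  apply: pr_snd; apply: (pr_iter (h := fun x => (x.2.1.+1, x.2.1))) => //.
    exact: pr_const.
  by apply: pr_pair; [apply: pr_succ|];
    apply: pr_fst; apply: pr_snd; exact: pr_id.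
apply: pr_ext h _ => a; suff -> n : iter n (fun p => (p.1.+1, p.1)) (0, 0) =
  (n, n.-1) by [].
by elim: n => //= n ->.
Qed.

Lemma pr_add A (cA : coded A) (f g : A -> nat) :
  pr f -> pr g -> pr (fun a => f a + g a).
Proof.
move=> pf pg; have h : pr (fun a => iter (f a) succn (g a)).
  by apply: (pr_iter (h := fun x => x.2.+1)) => //; apply: pr_succ;
    apply: pr_snd; exact: pr_id.
by apply: pr_ext h _ => a; rewrite iter_succn addnC.
Qed.

Lemma pr_sub A (cA : coded A) (f g : A -> nat) :
  pr f -> pr g -> pr (fun a => f a - g a).
Proof.
move=> pf pg; have h : pr (fun a => iter (g a) predn (f a)).
  by apply: (pr_iter (h := fun x => x.2.-1)) => //; apply: pr_pred;
    apply: pr_snd; exact: pr_id.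
by apply: pr_ext h _ => a; elim: (g a) => [|n] /=; rewrite ?subn0 // subnS => ->.
Qed.

Lemma pr_mul A (cA : coded A) (f g : A -> nat) :
  pr f -> pr g -> pr (fun a => f a * g a).
Proof.
move=> pf pg; have h : pr (fun a => iter (f a) (fun x => g a + x) 0).
  apply: (pr_iter (h := fun x => g x.1 + x.2)) => //; first exact: pr_const.
  apply: pr_add; last by apply: pr_snd; exact: pr_id.
  by apply: (pr_comp pg); apply: pr_fst; exact: pr_id.
by apply: pr_ext h _ => a; rewrite iter_addn_0 mulnC.
Qed.

Lemma pr_exp A (cA : coded A) (f g : A -> nat) :
  pr f -> pr g -> pr (fun a => f a ^ g a).
Proof.
move=> pf pg; have h : pr (fun a => iter (g a) (fun x => f a * x) 1).
  apply: (pr_iter (h := fun x => f x.1 * x.2)) => //; first exact: pr_const.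
  apply: pr_mul; last by apply: pr_snd; exact: pr_id.
  by apply: (pr_comp pf); apply: pr_fst; exact: pr_id.
by apply: pr_ext h _ => a; rewrite iter_muln_1.
Qed.

Lemma pr_is0 A (cA : coded A) (f : A -> nat) : pr f -> pr (fun a => f a == 0).
Proof.
move=> pf; have h : pr (fun a => iter (f a) (fun=> false) true).
  by apply: (pr_iter (h := fun=> false)) => //; exact: pr_const.
by apply: pr_ext h _ => a; case: (f a).
Qed.

Lemma pr_leq A (cA : coded A) (f g : A -> nat) :
  pr f -> pr g -> pr (fun a => f a <= g a).
Proof. by move=> pf pg; apply: pr_is0; exact: pr_sub. Qed.

Lemma pr_neg A (cA : coded A) (b : A -> bool) : pr b -> pr (fun a => ~~ b a).
Proof. by move=> pb; apply: pr_if => //; exact: pr_const. Qed.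

Lemma pr_and A (cA : coded A) (b c : A -> bool) :
  pr b -> pr c -> pr (fun a => b a && c a).
Proof. by move=> pb pc; apply: pr_if => //; exact: pr_const. Qed.

Lemma pr_or A (cA : coded A) (b c : A -> bool) :
  pr b -> pr c -> pr (fun a => b a || c a).
Proof. by move=> pb pc; apply: pr_if => //; exact: pr_const. Qed.

Lemma pr_eq A (cA : coded A) (f g : A -> nat) :
  pr f -> pr g -> pr (fun a => f a == g a).
Proof.
move=> pf pg; have h : pr (fun a => (f a <= g a) && (g a <= f a)).
  by apply: pr_and; exact: pr_leq.
by apply: pr_ext h _ => a; rewrite eqn_leq.
Qed.

Lemma pr_maxn A (cA : coded A) (f g : A -> nat) :
  pr f -> pr g -> pr (fun a => maxn (f a) (g a)).
Proof. by move=> pf pg; apply: pr_if => //; apply: pr_leq => //; exact: pr_succ. Qed.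

Lemma pr_odd A (cA : coded A) (f : A -> nat) : pr f -> pr (fun a => odd (f a)).
Proof.
move=> pf; have h : pr (fun a => iter (f a) negb false).
  apply: (pr_iter (h := fun x => ~~ x.2)) => //; first exact: pr_const.
  by apply: pr_neg; apply: pr_snd; exact: pr_id.
by apply: pr_ext h _ => a; elim: (f a) => //= n ->.
Qed.

Lemma pr_double A (cA : coded A) (f : A -> nat) :
  pr f -> pr (fun a => (f a).*2).
Proof.
move=> pf; apply: pr_ext (pr_add pf pf) _ => a; exact: addnn.
Qed.

Lemma pr_half A (cA : coded A) (f : A -> nat) : pr f -> pr (fun a => (f a)./2).
Proof.
move=> pf; have h : pr (fun a => (iter (f a)
    (fun p : nat * bool => (p.1 + p.2, ~~ p.2)) (0, false)).1).
  apply: pr_fst; apply: (pr_iter (h := fun x : A * (nat * bool) =>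
    (x.2.1 + x.2.2, ~~ x.2.2))) => //.
    exact: pr_const.
  have p2 : pr (fun x : A * (nat * bool) => x.2) by apply: pr_snd; exact: pr_id.
  apply: pr_pair; last by apply: pr_neg; exact: pr_snd p2.
  apply: pr_add; first exact: pr_fst p2.
  by case: (pr_snd p2) => k ck ek; exists k.
apply: pr_ext h _ => a; suff -> n : iter n
  (fun p : nat * bool => (p.1 + p.2, ~~ p.2)) (0, false) = (n./2, odd n) by [].
by elim: n => //= n ->; rewrite /= uphalf_half addnC.
Qed.

(** The tactics [pr_step] and [pr_step_seq] follow the head symbol of the body
    of a function; hypotheses on function variables are used by composition. *)
Ltac pr_step :=
  match goal with
  | |- pr (fun _ => _) => exact: pr_const
  | |- pr (fun x => x) => exact: pr_id
  | H : pr ?f |- pr ?f => exact: H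
  | |- pr (fun x => (_, _)) => apply: pr_pair
  | |- pr (fun x => fst _) => apply: pr_fst
  | |- pr (fun x => snd _) => apply: pr_snd
  | |- pr fst => apply: pr_fst
  | |- pr snd => apply: pr_snd
  | |- pr succn => apply: pr_succ
  | |- pr predn => apply: pr_pred
  | |- pr double => apply: pr_double
  | |- pr half => apply: pr_half
  | |- pr odd => apply: pr_odd
  | |- pr (fun x => if _ then _ else _) => apply: pr_if
  | |- pr (fun x => addn _ _) => apply: pr_add
  | |- pr (fun x => subn _ _) => apply: pr_sub
  | |- pr (fun x => muln _ _) => apply: pr_mul
  | |- pr (fun x => expn _ _) => apply: pr_exp
  | |- pr (fun x => leq _ _) => apply: pr_leq
  | |- pr (fun x => eq_op _ 0) => apply: pr_is0
  | |- pr (fun x => eq_op _ _) => apply: pr_eq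
  | |- pr (fun x => negb _) => apply: pr_neg
  | |- pr (fun x => andb _ _) => apply: pr_and
  | |- pr (fun x => orb _ _) => apply: pr_or
  | |- pr (fun x => maxn _ _) => apply: pr_maxn
  | |- pr (fun x => odd _) => apply: pr_odd
  | |- pr (fun x => half _) => apply: pr_half
  | |- pr (fun x => double _) => apply: pr_double
  | |- pr (fun x => S _) => apply: pr_succ
  | |- pr (fun x => predn _) => apply: pr_pred
  | H : pr ?h |- pr (fun x => ?h _) => apply: (pr_comp H)
  end.

Ltac pr_tac := repeat pr_step.

Lemma pr_cons (A C : Type) (cA : coded A) (cC : coded C)
    (x : A -> C) (s : A -> seq C) :
  pr x -> pr s -> pr (fun a => x a :: s a).
Proof. exact: pr_pair. Qed.

Lemma pr_behead (A C : Type) (cA : coded A) (cC : coded C)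
    (s : A -> seq C) : pr s -> pr (fun a => behead (s a)).
Proof.
move=> [h ch eh]; exists (tl \o h); first exact: calc_comp calc_tl.
by move=> a /=; rewrite -eh; case: (s a) => //= x r; rewrite tl_cpair.
Qed.

(** A list is nonempty when its code is nonzero, so no default element of [C] is
    involved. *)
Lemma pr_match (A C : Type) (cA : coded A) (cC : coded C) (B : Type) (cB : coded B)
    (s : A -> seq C) (f : A -> B)
    (g : A * (C * seq C) -> B) : pr s -> pr f -> pr g ->
  pr (fun a => if s a is x :: r then g (a, (x, r)) else f a).
Proof.
move=> [hs cs es] [hf cf ef] [hg cg eg].
exists (fun n => if hs n == 0 then hf n else hg (cpair n (hs n))).
  apply: pr_natP; apply: pr_if; last first.
  - by exists (fun n => hg (cpair n (hs n))) => //; apply: calc_comp cg;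
      apply: calc_pair => //; exact: calc_id.
  - by exists hf.
  - by apply: pr_is0; exists hs.
move=> a; rewrite -es; case: (s a) => [|x r] /=; first exact: ef.
have -> : (cd (x :: r) == 0) = false by apply/negbTE; rewrite muln_eq0 expn_eq0.
exact: eg.
Qed.

Lemma pr_head (A C : Type) (cA : coded A) (cC : coded C)
    (d : A -> C) (s : A -> seq C) :
  pr d -> pr s -> pr (fun a => head (d a) (s a)).
Proof.
move=> pd ps; apply: (pr_match (g := fun x => x.2.1)) => //.
by apply: pr_fst; apply: pr_snd; exact: pr_id.
Qed.

Lemma size_code (C : Type) (cC : coded C) (r : seq C) : size r <= cd r.
Proof.
elim: r => //= x r IH; rewrite {1}/cd /= /cpair.
apply: leq_trans (leq_pmull _ _); last by rewrite expn_gt0.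
by rewrite ltnS; apply: leq_trans IH _; rewrite -addnn leq_addr.
Qed.

(** The list is consumed by iteration of a step; its code is an upper bound on
    the number of rounds. *)
Lemma pr_foldl (A C : Type) (cA : coded A) (cC : coded C) (B : Type) (cB : coded B)
    (s : A -> seq C) (z : A -> B) (h : A * (B * C) -> B) :
  pr s -> pr z -> pr h ->
  pr (fun a => foldl (fun b c => h (a, (b, c))) (z a) (s a)).
Proof.
move=> ps pz ph.
pose step (q : A * (B * seq C)) : B * seq C :=
  if q.2.2 is x :: r then (h (q.1, (q.2.1, x)), r) else q.2.
have pstep : pr step.
  apply: (pr_match (s := fun q : A * (B * seq C) => q.2.2)
    (f := fun q => q.2) (g := fun w => (h (w.1.1, (w.1.2.1, w.2.1)), w.2.2)));
    by pr_tac.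
have hi : pr (fun a => (iter (cd (s a)) (fun q => step (a, q)) (z a, s a)).1).
  by apply: pr_fst; apply: pr_iter => //; pr_tac.
apply: pr_ext hi _ => a; have := size_code cC (s a).
elim: (s a) (cd (s a)) (z a) => [|x r IH] n b.
  move=> _; suff -> : iter n (fun q => step (a, q)) (b, [::]) = (b, [::]) by [].
  by elim: n => //= n ->.
by case: n => // n le; rewrite iterSr IH.
Qed.

Lemma pr_rev (A C : Type) (cA : coded A) (cC : coded C) (s : A -> seq C) :
  pr s -> pr (fun a => rev (s a)).
Proof.
move=> ps; have h : pr (fun a => foldl (fun b c => c :: b) [::] (s a)).
  apply: (pr_foldl (h := fun x => x.2.2 :: x.2.1)) => //; first exact: pr_const.
  by apply: pr_cons; pr_tac.
apply: pr_ext h _ => a; rewrite /rev.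
by elim: (s a) [::] => //= x r IH acc; rewrite IH.
Qed.

Lemma pr_foldr (A C : Type) (cA : coded A) (cC : coded C) (B : Type)
    (cB : coded B) (s : A -> seq C) (z : A -> B) (h : A * (C * B) -> B) :
  pr s -> pr z -> pr h ->
  pr (fun a => foldr (fun c b => h (a, (c, b))) (z a) (s a)).
Proof.
move=> ps pz ph.
have f : pr (fun a => foldl (fun b c => h (a, (c, b))) (z a) (rev (s a))).
  apply: (pr_foldl (h := fun x => h (x.1, (x.2.2, x.2.1)))) => //.
    exact: pr_rev.
  by pr_tac.
by apply: pr_ext f _ => a; rewrite foldl_rev.
Qed.

Lemma pr_map (A B C : Type) (cA : coded A) (cB : coded B) (cC : coded C)
    (s : A -> seq C) (h : A * C -> B) :
  pr s -> pr h -> pr (fun a => map (fun c => h (a, c)) (s a)).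
Proof.
move=> ps ph; apply: (pr_foldr (h := fun x => h (x.1, x.2.1) :: x.2.2)) => //.
  exact: pr_const.
by apply: pr_cons; pr_tac.
Qed.

Lemma pr_size (A C : Type) (cA : coded A) (cC : coded C) (s : A -> seq C) :
  pr s -> pr (fun a => size (s a)).
Proof.
move=> ps; have h : pr (fun a => foldr (fun c b => b.+1) 0 (s a)).
  by apply: (pr_foldr (h := fun x => x.2.2.+1)) => //; pr_tac.
by apply: pr_ext h _ => a; elim: (s a) => //= x r ->.
Qed.

Lemma pr_cat (A C : Type) (cA : coded A) (cC : coded C) (s t : A -> seq C) :
  pr s -> pr t -> pr (fun a => s a ++ t a).
Proof.
move=> ps pt; have h : pr (fun a => foldr cons (t a) (s a)).
  apply: (pr_foldr (h := fun x => x.2.1 :: x.2.2)) => //.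
  by apply: pr_cons; pr_tac.
by apply: pr_ext h _ => a; elim: (s a) => //= x r ->.
Qed.

Lemma pr_rcons (A C : Type) (cA : coded A) (cC : coded C) (s : A -> seq C)
    (x : A -> C) : pr s -> pr x -> pr (fun a => rcons (s a) (x a)).
Proof.
move=> ps px; have h : pr (fun a => s a ++ [:: x a]).
  by apply: pr_cat => //; apply: pr_cons => //; exact: pr_const.
by apply: pr_ext h _ => a; rewrite cats1.
Qed.

Lemma pr_drop (A C : Type) (cA : coded A) (cC : coded C) (n : A -> nat)
    (s : A -> seq C) : pr n -> pr s -> pr (fun a => drop (n a) (s a)).
Proof.
move=> pn ps; have h : pr (fun a => iter (n a) behead (s a)).
  by apply: (pr_iter (h := fun x => behead x.2)) => //; apply: pr_behead; pr_tac.
apply: pr_ext h _ => a; elim: (n a) (s a) => [|k IH] r; first by rewrite drop0.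
by rewrite iterSr IH; case: r => //=; case: k {IH}.
Qed.

Lemma pr_take (A C : Type) (cA : coded A) (cC : coded C) (n : A -> nat)
    (s : A -> seq C) : pr n -> pr s -> pr (fun a => take (n a) (s a)).
Proof.
move=> pn ps.
have h : pr (fun a => rev (drop (size (s a) - n a) (rev (s a)))).
  apply: pr_rev; apply: pr_drop; last exact: pr_rev.
  by apply: pr_sub => //; exact: pr_size.
apply: pr_ext h _ => a; rewrite drop_rev revK.
case: (leqP (n a) (size (s a))) => [le|/ltnW le]; first by rewrite subKn.
by move: (le); rewrite -subn_eq0 => /eqP ->; rewrite subn0 take_size take_oversize.
Qed.

Lemma pr_nth (A C : Type) (cA : coded A) (cC : coded C) (d : A -> C)
    (s : A -> seq C) (n : A -> nat) :
  pr d -> pr s -> pr n -> pr (fun a => nth (d a) (s a) (n a)).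
Proof.
move=> pd ps pn; have h : pr (fun a => head (d a) (drop (n a) (s a))).
  by apply: pr_head => //; exact: pr_drop.
by apply: pr_ext h _ => a; rewrite -nth0 nth_drop addn0.
Qed.

Lemma pr_iota (A : Type) (cA : coded A) (n : A -> nat) :
  pr n -> pr (fun a => iota 0 (n a)).
Proof.
move=> pn; have h : pr (fun a => iter (n a) (fun r => rcons r (size r)) [::]).
  apply: (pr_iter (h := fun x => rcons x.2 (size x.2))) => //.
    exact: pr_const.
  by apply: pr_rcons; [|apply: pr_size]; pr_tac.
apply: pr_ext h _ => a; elim: (n a) => // k IH.
by rewrite iterS IH size_iota -addn1 iotaD cats1.
Qed.

Lemma pr_mkseq (A B : Type) (cA : coded A) (cB : coded B) (n : A -> nat)
    (h : A * nat -> B) :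
  pr n -> pr h -> pr (fun a => mkseq (fun i => h (a, i)) (n a)).
Proof. by move=> pn ph; apply: pr_map => //; exact: pr_iota. Qed.

Lemma pr_has (A C : Type) (cA : coded A) (cC : coded C) (s : A -> seq C)
    (h : A * C -> bool) :
  pr s -> pr h -> pr (fun a => has (fun c => h (a, c)) (s a)).
Proof.
move=> ps ph.
apply: (pr_foldr (h := fun x => h (x.1, x.2.1) || x.2.2)) => //; by pr_tac.
Qed.

Lemma pr_all (A C : Type) (cA : coded A) (cC : coded C) (s : A -> seq C)
    (h : A * C -> bool) :
  pr s -> pr h -> pr (fun a => all (fun c => h (a, c)) (s a)).
Proof.
move=> ps ph.
apply: (pr_foldr (h := fun x => h (x.1, x.2.1) && x.2.2)) => //; by pr_tac.
Qed.

Lemma pr_nseq (A C : Type) (cA : coded A) (cC : coded C) (n : A -> nat)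
    (x : A -> C) : pr n -> pr x -> pr (fun a => nseq (n a) (x a)).
Proof.
move=> pn px; have h : pr (fun a => mkseq (fun=> x a) (n a)).
  by apply: (pr_mkseq (h := fun y => x y.1)) => //; pr_tac.
apply: pr_ext h _ => a; rewrite /mkseq.
by elim: (n a) 0 => //= k IH m; rewrite IH.
Qed.

Lemma pr_flatten (A C : Type) (cA : coded A) (cC : coded C)
    (s : A -> seq (seq C)) : pr s -> pr (fun a => flatten (s a)).
Proof.
move=> ps; apply: (pr_foldr (h := fun x => x.2.1 ++ x.2.2)) => //.
  exact: pr_const.
by apply: pr_cat; pr_tac.
Qed.

Lemma cd_seq_nat (r : seq nat) : cd r = CodeSeq.code r.
Proof. by []. Qed.

Lemma pr_decode (A : Type) (cA : coded A) (n : A -> nat) :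
  pr n -> pr (fun a => CodeSeq.decode (n a)).
Proof.
move=> [h ch eh]; exists h => // a; rewrite cd_seq_nat CodeSeq.decodeK; exact: eh.
Qed.

Ltac pr_step_seq :=
  match goal with
  | |- pr (fun x => cons _ _) => apply: pr_cons
  | |- pr (fun x => behead _) => apply: pr_behead
  | |- pr (fun x => head _ _) => apply: pr_head
  | |- pr (fun x => rev _) => apply: pr_rev
  | |- pr (fun x => size _) => apply: pr_size
  | |- pr (fun x => cat _ _) => apply: pr_cat
  | |- pr (fun x => rcons _ _) => apply: pr_rcons
  | |- pr (fun x => drop _ _) => apply: pr_drop
  | |- pr (fun x => take _ _) => apply: pr_take
  | |- pr (fun x => nth _ _ _) => apply: pr_nth
  | |- pr (fun x => iota 0 _) => apply: pr_iota
  | |- pr (fun x => nseq _ _) => apply: pr_nseq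
  | |- pr (fun x => flatten _) => apply: pr_flatten
  | |- pr (fun x => CodeSeq.decode _) => apply: pr_decode
  | |- pr (fun x => mkseq (fun i => @?h x i) (@?n x)) =>
      apply (@pr_mkseq _ _ _ _ n (fun y => h (fst y) (snd y))); cbv beta
  | |- pr (fun x => map (fun i => @?h x i) (@?n x)) =>
      apply (@pr_map _ _ _ _ _ _ n (fun y => h (fst y) (snd y))); cbv beta
  | |- pr (fun x => has (fun i => @?h x i) (@?n x)) =>
      apply (@pr_has _ _ _ _ n (fun y => h (fst y) (snd y))); cbv beta
  | |- pr (fun x => all (fun i => @?h x i) (@?n x)) =>
      apply (@pr_all _ _ _ _ n (fun y => h (fst y) (snd y))); cbv beta
  | |- pr (fun x => iter (@?n x) (fun i => @?h x i) (@?z x)) =>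
      apply (@pr_iter _ _ _ _ n z (fun y => h (fst y) (snd y))); cbv beta
  end.

Ltac prs := repeat first [pr_step | pr_step_seq].

(** * Universal simulation *)

(** Instruction address, input position, tapes and output.  A machine uses only
    finitely many tapes, so that a list of tapes is enough. *)
Definition sim_config : Type := ((nat * nat) * (seq tape * seq bool))%type.

Definition sim_write (T : seq tape) (k : nat) (tp : tape) : seq tape :=
  mkseq (fun i => if i == k then tp else nth ([::], [::]) T i)
    (maxn (size T) k.+1).

(** The instruction is analysed through its code, whence machines themselves
    need no coding. *)
Definition sim_step (n : nat) (w : seq bool) (c : sim_config) : sim_config :=
  let a := CodeSeq.decode (nth 0 (CodeSeq.decode n) c.1.1) in
  let isa m op := (size a == m) && (nth 0 a 0 == op) in
  let arg j := nth 0 a j in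
  let tp := nth ([::], [::]) c.2.1 (arg 1) in
  if isa 1 1 then ((c.1.1.+1, c.1.2.+1), c.2) else
  if isa 2 2 then ((if nth false w c.1.2 then arg 1 else c.1.1.+1, c.1.2), c.2) else
  if isa 2 3 then ((c.1.1.+1, c.1.2), (c.2.1, rcons c.2.2 (0 < arg 1))) else
  if isa 3 4 then
    ((c.1.1.+1, c.1.2),
      (sim_write c.2.1 (arg 1)
         (if 0 < arg 2 then (head 0 tp.2 :: tp.1, behead tp.2)
          else (behead tp.1, head 0 tp.1 :: tp.2)), c.2.2)) else
  if isa 3 5 then
    ((c.1.1.+1, c.1.2),
      (sim_write c.2.1 (arg 1) (tp.1, arg 2 :: behead tp.2), c.2.2)) else
  if isa 4 6 then
    ((if head 0 tp.2 == arg 2 then arg 3 else c.1.1.+1, c.1.2), c.2)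
  else c.

Definition sim (n : nat) (w : seq nat) (t : nat) : seq bool :=
  (iter t (sim_step n (unaries w)) ((0, 0), ([::], [::]))).2.2.

Lemma pr_unaries A (cA : coded A) (s : A -> seq nat) :
  pr s -> pr (fun a => unaries (s a)).
Proof.
move=> ps.
have h : pr (fun a => flatten (map (fun x => rcons (nseq x true) false) (s a))).
  by prs.
exact: h.
Qed.

Lemma pr_sim A (cA : coded A) (n t : A -> nat) (w : A -> seq nat) :
  pr n -> pr w -> pr t -> pr (fun a => sim (n a) (w a) (t a)).
Proof.
move=> pn pw pt; have pu := pr_unaries pw; apply: pr_snd; apply: pr_snd.
apply: (pr_iter (h := fun x => sim_step (n x.1) (unaries (w x.1)) x.2)) => //.
  exact: pr_const.
have pn1 : pr (fun x : A * sim_config => n x.1) by apply: (pr_comp pn); prs.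
have pu1 : pr (fun x : A * sim_config => unaries (w x.1)).
  by apply: (pr_comp pu); prs.
rewrite /sim_step /sim_write /=; prs.
Qed.

Definition simulates (c : config) (d : sim_config) : Prop :=
  [/\ pc c = d.1.1, input_pos c = d.1.2, output c = d.2.2 &
    forall k, work c k = nth ([::], [::]) d.2.1 k].

Lemma nth_sim_write T k tp j :
  nth ([::], [::]) (sim_write T k tp) j =
  if j == k then tp else nth ([::], [::]) T j.
Proof.
case: (ltnP j (maxn (size T) k.+1)) => [lt|]; first by rewrite nth_mkseq.
rewrite geq_max => /andP[h1 h2]; rewrite nth_default ?size_mkseq ?geq_max ?h1 //.
by rewrite nth_default // gtn_eqF.
Qed.

Lemma sim_stepP n w c d : simulates c d ->
  simulates (step (machine n) (nth false w) c) (sim_step n w d).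
Proof.
case: c => l i T o; case: d => [[l' i'] [T' o']] [/= -> -> -> hT].
have -> : nth Halt (machine n) l' = instr_of_nat (nth 0 (CodeSeq.decode n) l').
  case: (ltnP l' (size (CodeSeq.decode n))) => h; first exact: nth_map.
  by rewrite !nth_default // size_map.
rewrite /instr_of_nat /sim_step /=; move: (nth 0 _ l') => m.
case: (CodeSeq.decode m) => [|op [|x [|y [|z [|u r]]]]] //=;
  do 7?case: op => [|op] //=; split=> //=; try (by rewrite /scan hT); move=> k;
  rewrite nth_sim_write; case: eqP => // _; rewrite ?hT //;
  by rewrite /move_head; case: ifP.
Qed.

Lemma input_pos_run M w t : input_pos (run M w t) <= t.
Proof.
elim: t => // t IH; rewrite /run iterS -/(run M w t).
case: (run M w t) IH => l i T o /= le.
by case: (nth _ _ _) => *; rewrite //= ?(leqW le).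
Qed.

(** The input tape is read one cell at a time. *)
Lemma run_local M w w' s t :
  (forall k, k < s -> w k = w' k) -> t <= s -> run M w t = run M w' t.
Proof.
move=> e; elim: t => // t IH lt; rewrite /run !iterS -/(run M w t).
rewrite -[iter t (step M w') _]/(run M w' t) -IH; last exact: ltnW.
have := input_pos_run M w t; case: (run M w t) => l i T o /= le.
by case: (nth _ _ _) => // l'; rewrite e //; apply: leq_ltn_trans le _.
Qed.

(** In [t] steps at most [t] cells are read, and each input value occupies at
    least one cell, so a prefix of length [t] determines the run. *)
Lemma simE n p s t : t <= s ->
  sim n (mkseq p s) t = output (run (machine n) (unary_word p) t).
Proof.
move=> ts; rewrite (@run_local _ _ (nth false (unaries (mkseq p s))) s) //.
  suff : simulates (run (machine n) (nth false (unaries (mkseq p s))) t)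
      (iter t (sim_step n (unaries (mkseq p s))) ((0, 0), ([::], [::]))) by case.
  elim: t {ts} => [|t IH]; first by split=> //= k; rewrite nth_nil.
  by rewrite /run !iterS; exact: sim_stepP.
move=> k hk; apply: unary_wordE; apply: leq_trans (size_unaries _).
by rewrite size_mkseq.
Qed.

(** * Output of a machine as a sequence of numbers *)

Definition parse_step (st : seq nat * nat) (b : bool) : seq nat * nat :=
  if b then (st.1, st.2.+1) else (rcons st.1 st.2, 0).

(** The numbers whose unary representation is complete. *)
Definition parse (bs : seq bool) : seq nat := (foldl parse_step ([::], 0) bs).1.

Lemma pr_parse A (cA : coded A) (f : A -> seq bool) :
  pr f -> pr (fun a => parse (f a)).
Proof.
move=> pf; apply: pr_fst.
apply: (pr_foldl (h := fun x => parse_step x.2.1 x.2.2)) => //.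
  exact: pr_const.
by rewrite /parse_step; prs.
Qed.

(** The ones at the end belong to a number that is not yet complete. *)
Lemma parse_decomp bs : exists r, bs = unaries (parse bs) ++ nseq r true.
Proof.
suff h : forall xs r, foldl parse_step ([::], 0) bs = (xs, r) ->
    bs = unaries xs ++ nseq r true.
  by exists (foldl parse_step ([::], 0) bs).2; apply: h; rewrite /parse; case: foldl.
elim/last_ind: bs => [|bs b IH] xs r; first by case=> <- <-.
rewrite foldl_rcons; case: (foldl _ _ _) IH => ys m /(_ _ _ erefl) ->.
rewrite /parse_step /=; case: b => -[<- <-].
  by rewrite rcons_cat; congr (_ ++ _); elim: m => //= m ->.
by rewrite cats0 unaries_rcons rcons_cat.
Qed.

Lemma foldl_parse_acc xs m bs : (foldl parse_step (xs, m) bs).1 =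
  xs ++ (foldl parse_step ([::], m) bs).1.
Proof.
elim: bs xs m => [|b bs IH] xs m /=; first by rewrite cats0.
rewrite /parse_step; case: b => /=; first exact: IH.
by rewrite IH [in RHS]IH catA cats1.
Qed.

Lemma parse_unaries xs bs : parse (unaries xs ++ bs) = xs ++ parse bs.
Proof.
rewrite /parse; elim: xs => //= x xs IH.
have h m : foldl parse_step ([::], m) (unary x ++ unaries xs ++ bs) =
    foldl parse_step ([:: m + x], 0) (unaries xs ++ bs).
  elim: x m => [|x IHx] m /=; first by rewrite addn0.
  by rewrite -[rcons _ _]/(unary x) IHx /= addSnnS.
by rewrite -catA h foldl_parse_acc IH.
Qed.

Lemma mkseq_unary_word q k :
  mkseq (unary_word q) k = take k (unaries (mkseq q k)).
Proof.
have le := size_unaries (mkseq q k); rewrite size_mkseq in le.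
apply: (@eq_from_nth _ false) => [|i].
  by rewrite size_mkseq size_takel.
rewrite size_mkseq => hi; rewrite nth_mkseq // nth_take // (@unary_wordE _ k) //.
exact: leq_trans hi le.
Qed.

Lemma mkseq_unary_word_size q k :
  mkseq (unary_word q) (size (unaries (mkseq q k))) = unaries (mkseq q k).
Proof.
apply: (@eq_from_nth _ false); first by rewrite size_mkseq.
by move=> i; rewrite size_mkseq => hi; rewrite nth_mkseq // -unary_wordE.
Qed.

Definition out (n : nat) (p : baire) (t : nat) : seq nat :=
  parse (output (run (machine n) (unary_word p) t)).

(** Numbers and symbols of the output converge together, since the unary words
    of [k] numbers have at least [k] symbols. *)
Lemma PhiP n p q : Phi n p q <-> forall k, exists t, take k (out n p t) = mkseq q k.
Proof.
split=> h k.
  have [t] := h (size (unaries (mkseq q k))); rewrite mkseq_unary_word_size => e.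
  exists t; rewrite /out -(cat_take_drop (size (unaries (mkseq q k))) (output _)).
  by rewrite e parse_unaries take_size_cat // size_mkseq.
have [t e] := h k; exists t; rewrite mkseq_unary_word.
have [r ->] := parse_decomp (output (run (machine n) (unary_word p) t)).
rewrite -/(out n p t) -(cat_take_drop k (out n p t)) e unaries_cat -catA takel_cat //.
by have := size_unaries (mkseq q k); rewrite size_mkseq.
Qed.

Lemma output_mono M w t t' : t <= t' ->
  exists bs, output (run M w t') = output (run M w t) ++ bs.
Proof.
move=> /subnKC <-; elim: (t' - t) => [|m [bs IH]].
  by exists [::]; rewrite addn0 cats0.
rewrite addnS /run iterS -/(run M w (t + m)).
case: (run M w (t + m)) IH => l i T o /= ->.
case: (nth _ _ _) => *; try by exists bs.
by eexists; rewrite -cats1 -catA.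
Qed.

Lemma out_mono n p t t' : t <= t' -> exists xs, out n p t' = out n p t ++ xs.
Proof.
move=> /(output_mono (machine n) (unary_word p))[bs e]; rewrite /out e.
have [r {1}->] := parse_decomp (output (run (machine n) (unary_word p) t)).
by rewrite -catA parse_unaries; eexists.
Qed.

(** Output is never withdrawn, so every stage agrees with the limit. *)
Lemma Phi_out n p q t : Phi n p q -> out n p t = mkseq q (size (out n p t)).
Proof.
move=> /PhiP /(_ (size (out n p t)))[t' e].
have [xs e1] := out_mono n p (leq_maxl t t').
have [ys e2] := out_mono n p (leq_maxr t t').
have le : size (out n p t) <= size (out n p t').
  by rewrite -{1}(size_mkseq q (size (out n p t))) -e size_take_min geq_minr.
by rewrite -e -(takel_cat ys le) -e2 e1 take_size_cat.
Qed.

Lemma Phi_reaches n p q k : Phi n p q -> exists t, k <= size (out n p t).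
Proof.
move=> /PhiP /(_ k)[t e]; exists t.
by rewrite -{1}(size_mkseq q k) -e size_take_min geq_minr.
Qed.

Lemma Phi_single n p q q' : Phi n p q -> Phi n p q' -> q = q'.
Proof.
move=> h h'; apply/funext => k; have [t le] := Phi_reaches k.+1 h.
rewrite -(nth_mkseq 0 q le) -(nth_mkseq 0 q' le).
by rewrite -(Phi_out t h) -(Phi_out t h').
Qed.

(** * Machines from primitive recursive searches *)

Lemma hd_cd (A B : Type) (cA : coded A) (cB : coded B) (x : A) (y : B) :
  hd (cd (x, y)) = cd x.
Proof. exact: hd_cpair. Qed.

Lemma tl_cd (A B : Type) (cA : coded A) (cB : coded B) (x : A) (y : B) :
  tl (cd (x, y)) = cd y.
Proof. exact: tl_cpair. Qed.

Lemma take_mkseq (T : Type) (q : nat -> T) k s :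
  k <= s -> take k (mkseq q s) = mkseq q k.
Proof. by move=> /subnKC <-; rewrite mkseq_add take_size_cat ?size_mkseq. Qed.

Definition search_step (R : nat * seq nat -> bool) (V : nat * seq nat -> nat)
    (x : seq nat * nat) : seq nat * (nat * nat) :=
  let k := head 0 x.1 in
  let w := rcons (behead x.1) x.2 in
  if R (k, w) then (k.+1 :: w, (1, V (k, w))) else (k :: w, (0, 0)).

(** The machine keeps the part of the input that it has read and the number
    [k] of values that it has written.  After each input value it tests
    whether [R] allows value [k] to be computed from that part. *)
Lemma computable_search (R : nat * seq nat -> bool) (V : nat * seq nat -> nat) :
  pr R -> pr V -> exists n, forall p q,
    (forall k s, R (k, mkseq p s) -> V (k, mkseq p s) = q k) ->
    (forall k s, exists2 s', s <= s' & R (k, mkseq p s')) ->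
    Phi n p q.
Proof.
move=> pR pV.
have : pr (search_step R V) by rewrite /search_step /=; prs.
move=> [g cg eg].
have eg' a b : g (cpair a b) = cd (search_step R V (CodeSeq.decode a, b)).
  by rewrite eg [cd (_, b)]/(cpair (CodeSeq.code _) b) CodeSeq.decodeK.
have [|n hn] := mealy_machine cg.
  move=> a b; rewrite eg' /search_step; case: ifP => _.
    by rewrite /cd /= tl_cpair hd_cpair.
  by rewrite /cd /= tl_cpair hd_cpair.
exists n => p q hV hR.
have inv s : exists z, [/\ mealy_state g p s = cd z, behead z = mkseq p s &
    flatten (mkseq (mealy_out g p) s) = mkseq q (head 0 z)].
  elim: s => [|s [z [e1 e2 e3]]]; first by exists [::].
  have e4 : g (cpair (cd z) (p s)) = cd (search_step R V (z, p s)) by rewrite eg.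
  exists (search_step R V (z, p s)).1.
  rewrite [mealy_state _ _ _]/= e1 e4.
  rewrite [mkseq (mealy_out g p) _]mkseqS -cats1 flatten_cat e3 /mealy_out e1 e4.
  rewrite /search_step [(z, p s).1]/= [(z, p s).2]/= e2 -mkseqS.
  have fl (T : Type) (x : seq T) : flatten [:: x] = x by rewrite /= cats0.
  case: ifP => h; rewrite !(tl_cd, hd_cd) fl; split=> //; last by rewrite cats0.
  by rewrite (hV _ _ h) -[RHS]/(mkseq q (head 0 z).+1) [RHS]mkseqS -cats1.
pose K s := size (flatten (mkseq (mealy_out g p) s)).
have mono s s' : s <= s' -> K s <= K s'.
  by move=> /subnKC <-; rewrite /K mkseq_add flatten_cat size_cat leq_addr.
have KS s : R (K s, mkseq p s.+1) -> K s.+1 = (K s).+1.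
  have [z [e1 e2 e3]] := inv s; rewrite {1 3}/K e3 size_mkseq mkseqS => hz.
  rewrite /K mkseqS -cats1 flatten_cat size_cat e3 size_mkseq /mealy_out e1.
  have -> : g (cpair (cd z) (p s)) = cd (search_step R V (z, p s)) by rewrite eg.
  by rewrite /search_step /= e2 hz /cd /= tl_cpair hd_cpair addn1.
have grow k : exists s, k <= K s.
  elim: k => [|k [s le]]; first by exists 0.
  have [[//|s'] /= lt h] := hR k s.+1; exists s'.+1.
  have := leq_trans le (mono _ _ (lt : s <= s')); rewrite leq_eqVlt.
  case/orP => [/eqP e|lt']; last exact: leq_trans lt' (mono _ _ (leqnSn s')).
  by rewrite e KS // -e.
apply/PhiP => k; have [s le] := grow k; have [t ht] := hn p s; exists t.
have [z [_ _ e3]] := inv s; move: le; rewrite /out ht /K e3 size_mkseq => le.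
by rewrite -[unaries _]cats0 parse_unaries cats0 take_mkseq.
Qed.

(** * Semidecidable predicates on Baire space *)

(** The tests see finite prefixes only.  The parameter in [A] makes it possible
    to quantify over numbers. *)
Definition semidec (A : Type) (cA : coded A) (P : A -> baire -> Prop) : Prop :=
  exists2 V : A * seq nat -> bool, pr V &
    forall a p, P a p <-> exists L, V (a, mkseq p L).
Arguments semidec {A cA} P.

Lemma has_iotaP (f : nat -> bool) n :
  has f (iota 0 n) <-> exists2 i, i < n & f i.
Proof.
split=> [/hasP[i]|[i lt fi]]; first by rewrite mem_iota; exists i.
by apply/hasP; exists i; rewrite // mem_iota.
Qed.

Lemma semidec_ext (A : Type) (cA : coded A)
    (P Q : A -> baire -> Prop) :
  semidec P -> (forall a p, P a p <-> Q a p) -> semidec Q.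
Proof. by move=> [V pV h] e; exists V => // a p; rewrite -e. Qed.

(** A test can be made to accept every extension of an accepted prefix; then
    tests that succeed at different lengths succeed together. *)
Lemma semidec_mono (A : Type) (cA : coded A)
    (P : A -> baire -> Prop) : semidec P ->
  exists2 V : A * seq nat -> bool, pr V &
    (forall a p L L', L <= L' -> V (a, mkseq p L) -> V (a, mkseq p L')) /\
    forall a p, P a p <-> exists L, V (a, mkseq p L).
Proof.
move=> [V pV h].
pose W x := has (fun L => V (x.1, take L x.2)) (iota 0 (size x.2).+1).
have WP a p L : W (a, mkseq p L) <-> exists2 K, K <= L & V (a, mkseq p K).
  rewrite /W has_iotaP size_mkseq; split=> -[K le].
    by rewrite take_mkseq //; exists K.
  by exists K => //; rewrite take_mkseq.
exists W; first by rewrite /W; prs.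
split=> [a p L L' le /WP[K leK hK]|a p].
  by apply/WP; exists K => //; exact: leq_trans leK le.
rewrite h; split=> [[L hL]|[L /WP[K _ hK]]]; last by exists K.
by exists L; apply/WP; exists L.
Qed.

Lemma semidec_or (A : Type) (cA : coded A)
    (P Q : A -> baire -> Prop) :
  semidec P -> semidec Q -> semidec (fun a p => P a p \/ Q a p).
Proof.
move=> [V pV hV] [W pW hW]; exists (fun x => V x || W x); first by prs.
move=> a p; rewrite hV hW; split.
  by move=> [[L h]|[L h]]; exists L; rewrite h ?orbT.
by move=> [L /orP[h|h]]; [left|right]; exists L.
Qed.

Lemma semidec_ex (A : Type) (cA : coded A)
    (P : A * nat -> baire -> Prop) :
  semidec P -> semidec (fun a p => exists n, P (a, n) p).
Proof.
move=> /semidec_mono[V pV [mV hV]].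
exists (fun x => has (fun n => V ((x.1, n), x.2)) (iota 0 (size x.2).+1)).
  by prs.
move=> a p; split=> [[n /hV[L h]]|[L /has_iotaP[n _ h]]]; last first.
  by exists n; apply/hV; exists L.
exists (maxn n L); apply/has_iotaP; exists n.
  by rewrite size_mkseq ltnS leq_maxl.
by apply: mV h; exact: leq_maxr.
Qed.

(** The place that is looked up may depend on the parameters, in particular on
    numbers that are quantified later. *)
Lemma semidec_lookup (A : Type) (cA : coded A)
    (P : A * nat -> baire -> Prop) (idx : A -> nat) :
  semidec P -> pr idx -> semidec (fun a p => P (a, p (idx a)) p).
Proof.
move=> /semidec_mono[V pV [mV hV]] pi.
exists (fun x => (idx x.1 < size x.2) && V ((x.1, nth 0 x.2 (idx x.1)), x.2)).
  by prs.
move=> a p; split=> [/hV[L h]|[L /= /andP[]]].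
  exists (maxn (idx a).+1 L); rewrite size_mkseq leq_maxl /=.
  by rewrite nth_mkseq ?leq_maxl //; apply: mV h; exact: leq_maxr.
by rewrite size_mkseq => lt; rewrite nth_mkseq // => h; apply/hV; exists L.
Qed.

Lemma semidec_out (A : Type) (cA : coded A)
    (D : A * seq nat -> bool) (e t : A -> nat) :
  pr D -> pr e -> pr t -> semidec (fun a p => D (a, out (e a) p (t a))).
Proof.
move=> pD pe pt.
exists (fun x => (t x.1 <= size x.2) &&
  D (x.1, parse (sim (e x.1) x.2 (t x.1)))).
  apply: pr_and; first by prs.
  apply: (pr_comp pD); apply: pr_pair; first by prs.
  by apply: pr_parse; apply: pr_sim; prs.
move=> a p; split=> [h|[L /= /andP[]]].
  by exists (t a); rewrite /= size_mkseq leqnn simE.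
by rewrite size_mkseq => le; rewrite simE.
Qed.

(** A prefix of the substituted sequence is known once finitely many values of
    [p] are. *)
Lemma semidec_subst (A : Type) (cA : coded A)
    (P : A -> baire -> Prop) (F : A * (nat * nat) -> nat)
    (phi : A * nat -> nat) : semidec P -> pr F -> pr phi ->
  semidec (fun a p => P a (fun i => F (a, (i, p (phi (a, i)))))).
Proof.
move=> [V pV hV] pF pphi.
exists (fun x => has (fun L => all (fun i => phi (x.1, i) < size x.2) (iota 0 L) &&
    V (x.1, mkseq (fun i => F (x.1, (i, nth 0 x.2 (phi (x.1, i))))) L))
  (iota 0 (size x.2).+1)).
  by prs.
have e a p N L : all (fun i => phi (a, i) < N) (iota 0 L) ->
    mkseq (fun i => F (a, (i, nth 0 (mkseq p N) (phi (a, i))))) L =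
    mkseq (fun i => F (a, (i, p (phi (a, i))))) L.
  move=> /allP h; apply/eq_in_map => i /h lt.
  by rewrite nth_mkseq.
move=> a p; rewrite hV; split=> [[L h]|[N /has_iotaP[L _ /andP[]]]]; last first.
  by rewrite size_mkseq => al; rewrite e // => h; exists L.
pose N := maxn L (\max_(i < L) (phi (a, i : nat)).+1).
have al : all (fun i => phi (a, i) < N) (iota 0 L).
  apply/allP => i; rewrite mem_iota add0n => /andP[_ lt].
  apply: leq_trans (leq_maxr _ _).
  exact: (leq_bigmax (F := fun i : 'I_L => (phi (a, i : nat)).+1) (Ordinal lt)).
exists N; apply/has_iotaP; exists L; rewrite /= ?size_mkseq ?al ?e //.
by rewrite ltnS leq_maxl.
Qed.

Lemma semidec_pre (A B : Type) (cA : coded A) (cB : coded B)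
    (P : B -> baire -> Prop) (f : A -> B) :
  semidec P -> pr f -> semidec (fun a p => P (f a) p).
Proof.
move=> [V pV hV] pf; exists (fun x => V (f x.1, x.2)); first by prs.
by move=> a p; exact: hV.
Qed.

(** * Machines for semidecidable predicates and for substitutions *)

Lemma semidec_machine (P : baire -> Prop) :
  semidec (fun (_ : unit) p => P p) ->
  exists n (V : seq nat -> bool), forall p,
    Phi n p (fun k => ~~ V (mkseq p k)) /\ (P p <-> exists k, V (mkseq p k)).
Proof.
move=> [V pV hV].
have [||n hn] := @computable_search (fun x => x.1 <= size x.2)
  (fun x => ~~ V (tt, take x.1 x.2)).
- by prs.
- have h : pr (fun x : nat * seq nat => ~~ V (tt, take x.1 x.2)) by prs.
  by case: h => g cg eg; exists g.
exists n, (fun w => V (tt, w)) => p; split; last exact: hV.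
apply: hn => [k s|k s] /=; first by rewrite size_mkseq => le; rewrite take_mkseq.
by exists (maxn k s); rewrite ?leq_maxr // size_mkseq leq_maxl.
Qed.

Lemma computable_pr (f : baire) : pr f -> exists n, forall p, Phi n p f.
Proof.
move=> pf; have [||n hn] := @computable_search (fun=> true) (fun x => f x.1).
- by prs.
- by prs.
by exists n => p; apply: hn => // k s; exists s.
Qed.

(** The fixed sequence [p0] is produced by simulation of its own machine [m]. *)
Lemma computable_subst (m : nat) (p0 : baire) (F : nat * (nat * nat) -> nat)
    (phi psi : nat -> nat) :
  (forall p, Phi m p p0) -> pr F -> pr phi -> pr psi ->
  exists n, forall p, Phi n p (fun i => F (i, (p (phi i), p0 (psi i)))).
Proof.
move=> hm pF pphi ppsi.
have po : pr (fun x : nat * seq nat => parse (sim m x.2 (size x.2))).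
  by apply: pr_parse; apply: pr_sim; prs.
have [||n hn] := @computable_search
  (fun x => (phi x.1 < size x.2) &&
     (psi x.1 < size (parse (sim m x.2 (size x.2)))))
  (fun x => F (x.1, (nth 0 x.2 (phi x.1),
     nth 0 (parse (sim m x.2 (size x.2))) (psi x.1)))).
- by prs.
- by prs.
have so p s : parse (sim m (mkseq p s) s) = out m p s by rewrite simE.
exists n => p; apply: hn => [k s|k s]; rewrite /= ?size_mkseq ?so.
  move=> /andP[h1 h2]; rewrite nth_mkseq // (Phi_out s (hm p)) nth_mkseq //.
have [t lt] := Phi_reaches (psi k).+1 (hm p).
exists (maxn s (maxn (phi k).+1 t)); first exact: leq_maxl.
rewrite size_mkseq so -/(phi k < _) (leq_trans (leq_maxl _ t) (leq_maxr _ _)) /=.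
have le : t <= maxn s (maxn (phi k).+1 t).
  by rewrite (leq_trans (leq_maxr (phi k).+1 t)) // leq_maxr.
by have [xs ->] := out_mono m p le; rewrite size_cat (leq_trans lt) // leq_addr.
Qed.

Local Open Scope classical_set_scope.

(** * Realizers of closed sets *)

Lemma near_mkseq (p : {ptws nat -> nat}) L :
  \forall q \near p, mkseq q L = mkseq p L.
Proof.
elim: L => [|L IH]; first by near=> q.
have hL : \forall q \near p, q L = p L.
  have /(_ p) := @proj_continuous nat (fun=> nat) L.
  by move=> /discrete_cvg.
near=> q; rewrite !mkseqS; congr rcons; near: q.
  exact: IH.
exact: hL.
Unshelve. all: by end_near.
Qed.

Lemma continuous_local (g : baire -> baire) :
  (forall p k, exists L, forall p', mkseq p' L = mkseq p L -> g p' k = g p k) ->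
  continuous_pfun (fun p => [set g p]).
Proof.
move=> loc; split; first by move=> p q q' -> ->.
move=> V oV; exists (g @^-1` V); last by move=> p q ->.
rewrite openE => p /= Vp.
have h : {ptws, (g : {ptws nat -> nat} -> {ptws nat -> nat}) @
    (nbhs (p : {ptws nat -> nat})) --> g p}.
  apply/pointwise_cvgP => k.
  have [L hL] := loc p k.
  apply/discrete_cvg.
  have : \forall q \near (p : {ptws nat -> nat}), g q k = g p k.
    near=> q; apply: hL; near: q; exact: near_mkseq.
  by [].
by apply: h; apply: open_nbhs_nbhs; split.
Unshelve. all: by end_near.
Qed.

Definition prepend (n : nat) (q : baire) : baire :=
  fun k => if k is k'.+1 then q k' else n.

Lemma Phi_zero n p s :
  Phi n p s -> (exists k, s k = 0) <-> exists t, 0 \in out n p t.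
Proof.
move=> h; split=> [[k sk]|[t]].
  have [t lt] := Phi_reaches k.+1 h; exists t.
  by rewrite (Phi_out t h); apply/mapP; exists k; rewrite ?mem_iota.
by rewrite (Phi_out t h) => /mapP[k _ ->]; exists k.
Qed.

(** A zero in the output of the machine whose number heads the name refutes
    membership. *)
Lemma closed_repE (X : Type) (dX : representation X) (h : baire) (A : set X)
    (r : baire) (x : X) :
  closed_rep dX h A -> dX r x ->
  A x <-> ~ exists t, 0 \in out (h 0) (bpair (fun k => h k.+1) r) t.
Proof.
move=> [_ hA] rx; have [|s [b [hs hb e]]] := hA r x rx; first by eexists.
rewrite -(Phi_zero hs); rewrite /sierpinski_rep /= e in hb; rewrite -hb /char_fun.
split=> [Ax /set_mem //|nA].
by apply: contrapT => /mem_set.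
Qed.

Lemma sierpinski_char (X : Type) (A : set X) (x : X) (V : nat -> bool) (P : Prop) :
  (P <-> exists k, V k) -> (A x <-> ~ P) ->
  sierpinski_rep (fun k => ~~ V k) (char_fun (~` A) x).
Proof.
move=> PV AP; rewrite /sierpinski_rep /=.
have -> : (exists k, (~~ V k : nat) = 0) <-> P.
  by rewrite PV; split=> -[k hk]; exists k; move: hk; case: (V k).
rewrite /char_fun; split=> [/set_mem nA|hP]; last by apply/mem_set => /AP.
by apply: contrapT => hP; apply: nA; apply/AP.
Qed.

(** The machine writes a zero as soon as the condition is detected. *)
Lemma semidec_closed (P : baire -> Prop) :
  semidec (fun (_ : unit) p => P p) ->
  exists n, forall (X : Type) (dX : representation X) (A : set X) (q : baire),
    (forall r x, dX r x -> A x <-> ~ P (bpair q r)) ->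
    closed_rep dX (prepend n q) A.
Proof.
move=> /semidec_machine[n [V hV]]; exists n => X dX A q hA.
split=> [r s s'|r x rx _]; first exact: Phi_single.
have [h e] := hV (bpair q r).
exists (fun k => ~~ V (mkseq (bpair q r) k)), (char_fun (~` A) x); split=> //.
exact: sierpinski_char e (hA r x rx).
Qed.

Lemma mkseq_bpair q r r' k :
  mkseq r k = mkseq r' k -> mkseq (bpair q r) k = mkseq (bpair q r') k.
Proof.
move=> e; apply/eq_in_map => i; rewrite mem_iota add0n => /andP[_ lt].
rewrite /bpair; case: odd => //.
have lt' : i./2 < k by apply: leq_ltn_trans lt; rewrite -[leqRHS]half_double;
  apply: half_leq; rewrite -addnn leq_addr.
by rewrite -(nth_mkseq 0 r lt') -(nth_mkseq 0 r' lt') e.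
Qed.

(** Closed choice asks for a continuous realizer besides a name; the value [k]
    written by the machine depends on a prefix of length [k]. *)
Lemma semidec_rep_closed (P : baire -> Prop) (A : set baire) (q : baire) :
  semidec (fun (_ : unit) p => P p) -> (forall r, A r <-> ~ P (bpair q r)) ->
  rep_closed baire_rep A.
Proof.
move=> /semidec_machine[n [V hV]] hA.
exists (fun r => [set (fun k => ~~ V (mkseq (bpair q r) k) : nat) : baire]).
  apply: (@continuous_local (fun r k => ~~ V (mkseq (bpair q r) k))) => r k.
  by exists k => r' e; rewrite (mkseq_bpair q e).
split; first by move=> r s s' -> ->.
move=> r x -> _.
exists (fun k => ~~ V (mkseq (bpair q r) k)), (char_fun (~` A) r); split=> //.
have [_ e] := hV (bpair q r).
exact: sierpinski_char e (hA r).
Qed.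

Import Order.TTheory GRing.Theory Num.Theory.

(** * Cauchy names *)

Definition eps (R : realType) (i : nat) : R := (2%:R^-1 ^+ i)%R.

Lemma eps_gt0 (R : realType) i : (0 < eps R i)%R.
Proof. by rewrite exprn_gt0 // invr_gt0 ltr0n. Qed.

Lemma epsS (R : realType) i : (eps R i = eps R i.+1 + eps R i.+1)%R.
Proof. by rewrite /eps exprS; lra. Qed.

Lemma eps_le (R : realType) i j : i <= j -> (eps R j <= eps R i)%R.
Proof.
move=> ij; rewrite /eps ler_wiXn2l // ?invr_ge0 ?ler0n //.
by rewrite invf_le1 ?ltr0n // ler1n.
Qed.

Lemma eps_small (R : realType) (d : R) :
  (0 < d)%R -> exists N, forall n, N <= n -> (eps R n < d)%R.
Proof.
move=> d0; have [N _ h] := near_infty_natSinv_expn_lt (PosNum d0).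
by exists N => n /h /=; rewrite /eps mul1r exprVn.
Qed.

(** The smallness of [eps] lets non-strict bounds be proved up to [eps]. *)
Lemma le_eps (R : realType) (a b : R) N :
  (forall n, N <= n -> (a <= b + eps R n)%R) -> (a <= b)%R.
Proof.
move=> h; rewrite leNgt; apply/negP => lt.
have [M hM] := @eps_small R (a - b)%R ltac:(by rewrite subr_gt0).
have := h (maxn N M) (leq_maxl _ _); have := hM (maxn N M) (leq_maxr _ _).
by lra.
Qed.

Section Names.
Context (R : realType) (X : metricType R) (alpha : nat -> X).
Implicit Types (p q : baire) (x y : X).

Lemma cvg_mdistP (u : nat -> X) x :
  (u @ \oo --> x)%classic <->
  forall d : R, (0 < d)%R -> exists N, forall n, N <= n -> (mdist (u n) x < d)%R.
Proof.
rewrite metricType_numDomainType.cvgrPdist_lt; split=> h d d0.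
  by have [N _ hN] := h d d0; exists N => n /hN /=; rewrite metric_sym.
have [N hN] := h d d0; exists N => // n /hN /=; by rewrite metric_sym.
Qed.

(** A closed condition on [p] and [x], in contrast to the strict inequalities
    that define names. *)
Definition near_name p x : Prop := forall i, (mdist (alpha (p i)) x <= eps R i)%R.

Lemma cauchy_rep_near p x : cauchy_rep alpha p x -> near_name p x.
Proof.
move=> [hp /cvg_mdistP hx] i; apply: (@le_eps _ _ _ 0) => k _.
have [N hN] := hx _ (eps_gt0 R k).
have lt := hp (maxn N i.+1) i (leq_maxr _ _).
have := hN _ (leq_maxl N i.+1).
have := metric_triangle (alpha (p i)) (alpha (p (maxn N i.+1))) x.
have := metric_sym (alpha (p i)) (alpha (p (maxn N i.+1))).
by move: lt; rewrite -/(eps R i); lra.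
Qed.

Definition drop_first p : baire := fun i => p i.+1.

(** The shift makes up for the strict inequality in the definition of names. *)
Lemma shift_strict p i j : j < i ->
  (mdist (alpha (p i.+1)) (alpha (p j.+1)) <= eps R i.+1 + eps R j.+1)%R ->
  (mdist (alpha (drop_first p i)) (alpha (drop_first p j)) < eps R j)%R.
Proof.
move=> ji; rewrite /drop_first (epsS R j) => le; apply: le_lt_trans le _.
rewrite ltrD2r (epsS R j.+1); have := eps_gt0 R j.+2.
by have := @eps_le R j.+2 i.+1; rewrite ltnS => /(_ ji); lra.
Qed.

Lemma near_name_shift p x : near_name p x -> cauchy_rep alpha (drop_first p) x.
Proof.
move=> hp; split=> [i j ji|].
  apply: shift_strict => //.
  have := metric_triangle (alpha (p i.+1)) x (alpha (p j.+1)).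
  have := metric_sym x (alpha (p j.+1)).
  by have := hp i.+1; have := hp j.+1; lra.
apply/cvg_mdistP => d d0; have [N hN] := eps_small d0.
exists N => n le; apply: le_lt_trans (hp n.+1) (hN _ _).
exact: leq_trans le (leqnSn n).
Qed.

Lemma near_name_unique p x y : near_name p x -> near_name p y -> x = y.
Proof.
move=> hx hy; apply: mdist_positivity; apply/eqP.
rewrite eq_le mdist_ge0 andbT; apply: (@le_eps _ _ _ 1) => -[//|n] _.
rewrite add0r (epsS R n.+1) (epsS R n.+2).
have := metric_triangle x (alpha (p n.+3)) y.
have := metric_sym x (alpha (p n.+3)); have := hx n.+3; have := hy n.+3.
have := eps_gt0 R n.+3; lra.
Qed.

Lemma name_exists x : dense (range alpha) -> exists p, cauchy_rep alpha p x.
Proof.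
move=> dn; suff /choice[p hp] : forall i, exists n, (mdist (alpha n) x <= eps R i)%R.
  by exists (drop_first p); exact: near_name_shift.
move=> i; have [||y [hy [n _ e]]] := dn ((ball x (eps R i))^°)%classic.
- by exists x; apply: nbhsx_ballx; exact: eps_gt0.
- exact: open_interior.
exists n; move: hy; rewrite -e => /interior_subset.
by rewrite ballEmdist /= metric_sym => /ltW.
Qed.

(** The closed condition on [p] alone that lets a limit exist. *)
Definition near_cauchy p : Prop := forall i j,
  (mdist (alpha (p i)) (alpha (p j)) <= eps R i + eps R j)%R.

Lemma cauchy_rep_near_cauchy p x : cauchy_rep alpha p x -> near_cauchy p.
Proof.
move=> /cauchy_rep_near hp i j.
have := metric_triangle (alpha (p i)) x (alpha (p j)).
have := metric_sym x (alpha (p j)).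
by have := hp i; have := hp j; lra.
Qed.

Lemma near_cauchy_shift p : computable_polish alpha -> near_cauchy p ->
  exists x, cauchy_rep alpha (drop_first p) x.
Proof.
move=> [_ _ complete] hp.
have [|x hx] := complete (fun i => alpha (drop_first p i)).
  apply/cauchy_ballP => d d0.
  have [N hN] := eps_small d0.
  exists ([set alpha (drop_first p i) | i in [set i | N < i]],
    [set alpha (drop_first p i) | i in [set i | N < i]])%classic => /=.
    split; exists N.+1 => // n /= ln; by exists n.
  move=> [_ _] /= [[i Ni <-] [j Nj <-]].
  rewrite ballEmdist /=; apply: le_lt_trans (hp _ _) _.
  apply: le_lt_trans (hN N (leqnn _)); rewrite (epsS R N).
  by apply: lerD; apply: eps_le; exact: ltnW.
exists x; split=> // i j ji; exact: shift_strict.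
Qed.

End Names.

(** The strict comparison of [rational_of_nat c] with
    [2 ^ - i + 2 ^ - j + 2 ^ - k], with denominators cleared. *)
Definition exceeds (c i j k : nat) : bool :=
  let s := CodeSeq.decode c in
  nth 0 s 1 * (2 ^ i * 2 ^ j * 2 ^ k) +
    (nth 0 s 2).+1 * (2 ^ j * 2 ^ k + 2 ^ i * 2 ^ k + 2 ^ i * 2 ^ j)
  < nth 0 s 0 * (2 ^ i * 2 ^ j * 2 ^ k).

Lemma exceedsP (R : realType) c i j k :
  exceeds c i j k <-> (eps R i + eps R j + eps R k < rational_of_nat R c)%R.
Proof.
rewrite /exceeds /rational_of_nat; move: (CodeSeq.decode c) => s.
move: (nth 0 s 0) (nth 0 s 1) (nth 0 s 2) => a b d.
rewrite -(ltr_nat R) !(natrD, natrM, natrX) /eps !exprVn.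
have : (0 < 2%:R ^+ i :> R)%R by rewrite exprn_gt0 // ltr0n.
have : (0 < 2%:R ^+ j :> R)%R by rewrite exprn_gt0 // ltr0n.
have : (0 < 2%:R ^+ k :> R)%R by rewrite exprn_gt0 // ltr0n.
have : (0 < d.+1%:R :> R)%R by rewrite ltr0n.
move: (2%:R ^+ i)%R (2%:R ^+ j)%R (2%:R ^+ k)%R (d.+1%:R)%R => u v w e e0 w0 v0 u0.
rewrite ltr_pdivlMr //.
have e1 : ((u^-1 + v^-1 + w^-1) * (u * v * w) = v * w + u * w + u * v)%R.
  by field; rewrite !gt_eqF.
have uvw : (0 < u * v * w)%R by rewrite !mulr_gt0.
have -> : ((u^-1 + v^-1 + w^-1) * e < a%:R - b%:R)%R =
    ((v * w + u * w + u * v) * e < (a%:R - b%:R) * (u * v * w))%R.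
  by rewrite -e1 mulrAC ltr_pM2r.
by rewrite mulrBl ltrBrDl [(e * _)%R]mulrC.
Qed.

Section Far.
Context (R : realType) (X : metricType R) (alpha : nat -> X).

(** When [alpha a] and [alpha b] approximate two points within [eps i] and
    [eps j], this inequality refutes that the points are equal. *)
Definition far (x : (nat * nat) * (nat * nat)) : Prop :=
  (eps R x.2.1 + eps R x.2.2 < mdist (alpha x.1.1) (alpha x.1.2))%R.

(** A strict lower bound on a real number shows in a rational approximation that
    is good enough. *)
Lemma semidec_far :
  computable_polish alpha -> semidec (fun x (_ : baire) => far x).
Proof.
move=> [_ [F [_ [e hE]] [_ real]] _].
pose arg (x : (nat * nat) * (nat * nat)) : baire :=
  bpair (fun=> x.1.1) (fun=> x.1.2).
pose D (y : (((nat * nat) * (nat * nat)) * nat * nat) * seq nat) : bool :=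
  (y.1.1.2 < size y.2) &&
  exceeds (nth 0 y.2 y.1.1.2) y.1.1.1.2.1 y.1.1.1.2.2 y.1.1.2.
have pD : pr D by rewrite /D /exceeds /=; prs.
have pe : pr (fun a : ((nat * nat) * (nat * nat)) * nat * nat => e) by prs.
have pt : pr (fun a : ((nat * nat) * (nat * nat)) * nat * nat => a.2) by prs.
have h1 := semidec_out pD pe pt.
have h2 := @semidec_subst _ _ _
  (fun y : (((nat * nat) * (nat * nat)) * nat * nat) * (nat * nat) =>
     if odd y.2.1 then y.1.1.1.1.2 else y.1.1.1.1.1)
  (fun=> 0) h1 ltac:(by prs) ltac:(by prs).
have h3 := semidec_ex (semidec_ex h2).
apply: semidec_ext h3 _ => x p /=.
have [q Fq hd] : exists2 q, F (arg x) q &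
    @real_rep R q (mdist (alpha x.1.1) (alpha x.1.2)).
  have [||q [d [h4 h5 e6]]] := real (arg x) x.1; last by exists q; rewrite -?e6.
    by exists (fun=> x.1.1), (fun=> x.1.2).
  by eexists.
rewrite /far; move: (mdist _ _) hd => d hd.
have dE k : (`|d - rational_of_nat R (q k)| <= eps R k)%R :=
  cauchy_rep_near hd k.
have hq := hE _ _ Fq.
have -> : (fun i => if odd i then x.1.2 else x.1.1) = arg x by [].
rewrite /D /=; split=> [[k [t /andP[lt]]]|lt].
  rewrite (Phi_out t hq) nth_mkseq // => /(exceedsP R).
  by have := dE k; rewrite ler_distl => /andP[]; lra.
have [N hN] := @eps_small R ((d - eps R x.2.1 - eps R x.2.2) / 2)%R
  ltac:(by rewrite divr_gt0 ?ltr0n //; lra).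
have [t lt'] := Phi_reaches N.+1 hq.
exists N, t; rewrite lt' (Phi_out t hq) nth_mkseq //=; apply/(exceedsP R).
have := hN N (leqnn N); have := dE N; rewrite ler_distl => /andP[].
lra.
Qed.

End Far.

(** * Conditions on several sequences at once *)

Definition evens (p : baire) : baire := fun i => p i.*2.

Definition odds (p : baire) : baire := fun i => p i.*2.+1.

Lemma evens_bpair p q : evens (bpair p q) = p.
Proof. by apply/funext => i; rewrite /evens /bpair odd_double doubleK. Qed.

Lemma odds_bpair p q : odds (bpair p q) = q.
Proof. by apply/funext => i; rewrite /odds /bpair /= odd_double uphalf_double. Qed.

(** Such an [f] can be substituted in semidecidable predicates; all components
    of nested pairs are of this kind. *)
Definition reads (f : baire -> baire) : Prop :=
  exists2 phi : nat -> nat, pr phi & forall u i, f u i = u (phi i).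

Lemma reads_id : reads id.
Proof. by exists id => //; exact: pr_id. Qed.

Lemma reads_evens f : reads f -> reads (fun u => evens (f u)).
Proof. by move=> [phi p e]; exists (fun i => phi i.*2) => [|u i];
  [prs|exact: e]. Qed.

Lemma reads_odds f : reads f -> reads (fun u => odds (f u)).
Proof. by move=> [phi p e]; exists (fun i => phi i.*2.+1) => [|u i];
  [prs|exact: e]. Qed.

Lemma reads_shift f : reads f -> reads (fun u => drop_first (f u)).
Proof. by move=> [phi p e]; exists (fun i => phi i.+1) => [|u i];
  [prs|exact: e]. Qed.

Lemma reads_bpair f g : reads f -> reads g -> reads (fun u => bpair (f u) (g u)).
Proof.
move=> [phi p e] [psi p' e'].
exists (fun i => if odd i then psi i./2 else phi i./2); first by prs.
by move=> u i; rewrite /bpair e e'; case: odd.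
Qed.

Definition hits (n : nat) (p : baire) : Prop := exists t, 0 \in out n p t.

Definition conflict (n : nat) (p q : baire) : Prop :=
  exists t i, (i < size (out n p t)) && (nth 0 (out n p t) i != q i).

(** On the domain of machine [n], not being contradicted by the output is a
    closed condition that determines the value. *)
Lemma conflictP n p q q0 : Phi n p q0 -> ~ conflict n p q <-> q = q0.
Proof.
move=> h; split=> [nc|-> [t [i /andP[lt]]]]; last first.
  by rewrite (Phi_out t h) nth_mkseq // eqxx.
apply/funext => i; have [t lt] := Phi_reaches i.+1 h.
apply/eqP/negPn/negP => ne; apply: nc; exists t, i; rewrite lt.
by rewrite (Phi_out t h) nth_mkseq // eq_sym.
Qed.

Lemma semidec_far_reads (R : realType) (X : metricType R) (alpha : nat -> X) f g :
  computable_polish alpha -> reads f -> reads g ->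
  semidec (fun (_ : unit) u => exists i j, far alpha ((f u i, g u j), (i, j))).
Proof.
move=> hX [phi p e] [psi p' e'].
have h0 := semidec_far hX.
have h1 := @semidec_pre (unit * nat * nat * nat * nat) _ _ _ _
  (fun x => ((x.1.2, x.2), (x.1.1.1.2, x.1.1.2))) h0 ltac:(by prs).
have h2 := semidec_lookup h1 (idx := fun x => psi x.1.2) ltac:(by prs).
have h3 := semidec_lookup h2 (idx := fun x => phi x.1.2) ltac:(by prs).
apply: semidec_ext (semidec_ex (semidec_ex h3)) _ => a u /=.
by split=> -[i [j h]]; exists i, j; move: h; rewrite e e'.
Qed.

Lemma semidec_conflict n f g : reads f -> reads g ->
  semidec (fun (_ : unit) u => conflict n (f u) (g u)).
Proof.
move=> [phi p e] [psi p' e'].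
have h1 := @semidec_out (unit * nat * nat * nat) _ (fun y => (y.1.1.2 < size y.2) &&
  (nth 0 y.2 y.1.1.2 != y.1.2)) (fun=> n) (fun x => x.1.1.2) ltac:(by prs)
  ltac:(by prs) ltac:(by prs).
have h2 := semidec_lookup (semidec_subst (F := fun y => y.2.2)
  (phi := fun x => phi x.2) h1 ltac:(by prs) ltac:(by prs))
  (idx := fun x => psi x.2) ltac:(by prs).
apply: semidec_ext (semidec_ex (semidec_ex h2)) _ => a u /=.
have -> : (fun i => u (phi i)) = f u by apply/funext => i; rewrite e.
by split=> -[t [i h]]; exists t, i; move: h; rewrite e'.
Qed.

Lemma semidec_hits f : reads f -> semidec (fun n u => hits n (f u)).
Proof.
move=> [phi p e].
have h1 := @semidec_out (nat * nat) _ (fun y => has (fun v => v == 0) y.2)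
  (fun x => x.1) (fun x => x.2) ltac:(by prs) ltac:(by prs) ltac:(by prs).
have h2 := semidec_subst (F := fun y => y.2.2) (phi := fun x => phi x.2) h1
  ltac:(by prs) ltac:(by prs).
apply: semidec_ext (semidec_ex h2) _ => n u /=.
have -> : (fun i => u (phi i)) = f u by apply/funext => i; rewrite e.
by split=> -[t h]; exists t; move: h; rewrite has_pred1.
Qed.

Lemma semidec_hits_const n f : reads f ->
  semidec (fun (_ : unit) u => hits n (f u)).
Proof.
move=> rf; apply: (semidec_pre (f := fun _ : unit => n) (semidec_hits rf)).
exact: pr_const.
Qed.

Lemma semidec_hits_head f g : reads f -> reads g ->
  semidec (fun (_ : unit) u => hits (g u 0) (f u)).
Proof.
move=> rf [psi p e].
have h := semidec_pre (f := fun x : unit * nat => x.2) (semidec_hits rf) ltac:(by prs).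
have h' := semidec_lookup h (idx := fun=> psi 0) ltac:(by prs).
by apply: semidec_ext h' _ => a u /=; rewrite e.
Qed.

Section FarNames.
Context (R : realType) (X : metricType R) (alpha : nat -> X).

(** A violation of a bound on the distance to [x] is detected on a sufficiently
    late term of a name of [x]. *)
Lemma far_near_name p px x : cauchy_rep alpha px x ->
  near_name alpha p x <-> ~ exists i j, far alpha ((p i, px j), (i, j)).
Proof.
move=> /cauchy_rep_near hpx; rewrite /far /=; split=> [hp [i [j]]|hp i].
  have := metric_triangle (alpha (p i)) x (alpha (px j)).
  have := metric_sym x (alpha (px j)).
  by have := hp i; have := hpx j; lra.
rewrite leNgt; apply/negP => lt; apply: hp.
have [N hN] := @eps_small R ((mdist (alpha (p i)) x - eps R i) / 2)%R
  ltac:(by rewrite divr_gt0 ?ltr0n ?subr_gt0).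
exists i, N; have := hN N (leqnn N).
have := metric_triangle (alpha (p i)) (alpha (px N)) x.
by have := hpx N; lra.
Qed.

Lemma far_near_cauchy q :
  near_cauchy alpha q <-> ~ exists i j, far alpha ((q i, q j), (i, j)).
Proof.
rewrite /far /=; split=> [hq [i [j]]|hq i j]; first by rewrite ltNge hq.
by rewrite leNgt; apply/negP => lt; apply: hq; exists i, j.
Qed.

End FarNames.

(** * From a reduction to the graph *)

Lemma closed_rep_unique (h : baire) (A A' : set baire) :
  closed_rep baire_rep h A -> closed_rep baire_rep h A' -> A = A'.
Proof.
by move=> hA hA'; apply/seteqP; split=> r /=;
  rewrite (closed_repE (r := r) hA) // (closed_repE (r := r) hA').
Qed.

(** Every correct answer of closed choice is given by some realizer; this is one
    for the answer [r]. *)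
Definition favour (r : baire) : baire -> set baire := fun h =>
  [set s | exists A, [/\ closed_rep baire_rep h A,
    closed_choice baire_rep A !=set0 &
    s = if pselect (closed_choice baire_rep A r) then r
        else xget (fun=> 0) (closed_choice baire_rep A)]].

Lemma favour_realizes r :
  realizes (closed_rep baire_rep) baire_rep (favour r) (closed_choice baire_rep).
Proof.
split=> [h s s' [A [hA _ ->]] [A' [hA' _ ->]]|h A hA [s0 hs0]].
  by rewrite (closed_rep_unique hA hA').
have [yes|no] := pselect (closed_choice baire_rep A r).
  exists r, r; split=> //; exists A; split=> //; first by exists s0.
  by case: pselect.
exists (xget (fun=> 0) (closed_choice baire_rep A)),
  (xget (fun=> 0) (closed_choice baire_rep A)); split=> //.
  exists A; split=> //; first by exists s0.
  by case: pselect.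
exact: xgetI hs0.
Qed.

Section Directions.
Context (R : realType) (X Y : metricType R) (alphaX : nat -> X) (alphaY : nat -> Y).
Context (hX : computable_polish alphaX) (hY : computable_polish alphaY).
Context (f : X -> Y).
Let dX := cauchy_rep alphaX.
Let dY := cauchy_rep alphaY.

(** Since [favour r] realizes closed choice for every [r], the answer of [K] is
    correct on all elements of the closed set. *)
Lemma reduction_answers (K H : baire -> set baire) :
  computable H ->
  (forall G, realizes (closed_rep baire_rep) baire_rep G (closed_choice baire_rep) ->
    realizes dX dY (fun p => [set r | exists h s,
      [/\ H p h, G h s & K (bpair p s) r]]) (mfun_of f)) ->
  forall p x, dX p x -> exists h A, [/\ H p h, closed_rep baire_rep h A,
    A !=set0 & forall r, A r -> exists2 q, K (bpair p r) q & dY q (f x)].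
Proof.
move=> [sH _] red p x px.
have ans r : exists q h s, [/\ H p h, favour r h s, K (bpair p s) q & dY q (f x)].
  have [_ /(_ p x px)] := red _ (favour_realizes r).
  move=> [|q [y [[h [s [h1 h2 h3]]] qy e]]]; first by eexists.
  by exists q, h, s; split; rewrite -?e.
have [_ [h [_ [Hh [A [hA [s0 As0] _]] _ _]]]] := ans (fun=> 0).
exists h, A; split=> //; first by exists s0; case: As0.
move=> r Ar; have [q [h' [s [Hh' [A' [hA' _ e]] Kq qy]]]] := ans r.
exists q => //; move: Kq; rewrite e; case: pselect => // nA; case: nA.
rewrite (sH _ _ _ Hh' Hh) in hA'; rewrite (closed_rep_unique hA' hA).
by split=> //; case: As0.
Qed.

(** The conditions on [p] and [q] refer to the points [x] and [y], all others
    to the witness alone.  A name of the point [((x, y), z)] contains names of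
    [x] and [y], from which the violation of the former is detected. *)
Lemma borel_of_weihrauch :
  weihrauch_le dX dY (mfun_of f) (closed_rep baire_rep) baire_rep
    (closed_choice baire_rep) ->
  effectively_Borel dX dY f.
Proof.
move=> [K [H [cK cH red]]].
have ans := reduction_answers cH red.
have [_ [nK hK]] := cK; have [_ [nH hH]] := cH.
(* A witness [z] is the nested pair of [p], [q], [r] and [h], in this order. *)
pose P z := evens z. pose Q z := evens (odds z).
pose S z := evens (odds (odds z)). pose N z := odds (odds (odds z)).
pose bad z := [\/ conflict nH (drop_first (P z)) (N z),
   hits (N z 0) (bpair (drop_first (N z)) (S z)) |
   conflict nK (bpair (drop_first (P z)) (S z)) (Q z)].
pose B : set ((X * Y) * baire) := [set w | [/\ near_name alphaX (P w.2) w.1.1,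
  near_name alphaY (Q w.2) w.1.2 & ~ bad w.2]].
pose names u := evens (odds u).
pose wit u := odds (odds u).
pose viol u :=
  (exists i j, far alphaX ((P (wit u) i, evens (names u) j), (i, j))) \/
  (exists i j, far alphaY ((Q (wit u) i, odds (names u) j), (i, j))) \/
  conflict nH (drop_first (P (wit u))) (N (wit u)) \/
  hits (N (wit u) 0) (bpair (drop_first (N (wit u))) (S (wit u))) \/
  conflict nK (bpair (drop_first (P (wit u))) (S (wit u))) (Q (wit u)).
have sv : semidec (fun (_ : unit) u => viol u).
  have ro := reads_odds reads_id; have rz := reads_odds ro.
  have rP := reads_evens rz; have rQ := reads_evens (reads_odds rz).
  have rS := reads_evens (reads_odds (reads_odds rz)).
  have rN := reads_odds (reads_odds (reads_odds rz)).
  have rx := reads_evens (reads_evens ro); have ry := reads_odds (reads_evens ro).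
  exact: (semidec_or (semidec_far_reads hX rP rx)
    (semidec_or (semidec_far_reads hY rQ ry)
    (semidec_or (semidec_conflict nH (reads_shift rP) rN)
    (semidec_or (semidec_hits_head (reads_bpair (reads_shift rN) rS) rN)
       (semidec_conflict nK (reads_bpair (reads_shift rP) rS) rQ))))).
have [n hn] := semidec_closed sv.
exists B.
  exists (prepend n (fun=> 0)).
    split; first by move=> ? ? ? -> ->.
    have [|m hm] := @computable_pr (prepend n (fun=> 0)).
      apply: (@pr_ext _ _ _ _ (fun k => if k == 0 then n else 0)); first by prs.
      by case.
    by exists m => p q ->.
  apply: hn => r [[x y] z] [pq [z' [-> [px [py [-> /= hpx hpy]]]]]] <-.
  rewrite /viol /names /wit !odds_bpair evens_bpair odds_bpair evens_bpair /B /=.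
  have nx := far_near_name (P z) hpx; have ny := far_near_name (Q z) hpy.
  rewrite /bad; split=> [[/nx h1 /ny h2 h3]|nv].
    by move=> [|[|[|[|]]]] h //; apply: h3; [apply: Or31|apply: Or32|apply: Or33].
  split; [apply/nx => h|apply/ny => h|case=> h]; apply: nv.
  - by left.
  - by right; left.
  - by right; right; left.
  - by right; right; right; left.
  - by right; right; right; right.
move=> [x y] /=; split=> [->|[z [/= hp hq nb]]].
  have [p hp] := name_exists x (alpha_dense hX).
  have hp' := near_name_shift (cauchy_rep_near hp).
  have [h [A [Hh hA [r Ar] hr]]] := ans _ _ hp'.
  have [q Kq hq] := hr r Ar.
  exists (bpair p (bpair q (bpair r h))); rewrite /B /bad /P /Q /S /N /=.
  rewrite !(odds_bpair, evens_bpair); split; try exact: cauchy_rep_near.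
  case=> c.
  - by move: c; apply/(conflictP _ (hH _ _ Hh)).
  - by move: c; apply/(closed_repE (r := r) hA).
  - by move: c; apply/(conflictP _ (hK _ _ Kq)).
have hp' := near_name_shift hp.
have [h [A [Hh hA _ hr]]] := ans _ _ hp'.
have eh : N z = h.
  by apply/(conflictP _ (hH _ _ Hh)) => c; apply: nb; exact: Or31.
have AS : A (S z).
  by apply/(closed_repE (r := S z) hA) => // c; apply: nb; apply: Or32; rewrite eh.
have [q Kq hq'] := hr _ AS.
have eq : Q z = q.
  by apply/(conflictP _ (hK _ _ Kq)) => c; apply: nb; exact: Or33.
rewrite eq in hq; exact: near_name_unique hq (cauchy_rep_near hq').
Qed.

(** * From the graph to a reduction *)

(** The name written by [H] consists of a fixed machine number, the sequence
    in the name of [B], and the name of [x]; [K] takes the first component of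
    the answer and drops its first term. *)
Lemma weihrauch_of_borel :
  effectively_Borel dX dY f ->
  weihrauch_le dX dY (mfun_of f) (closed_rep baire_rep) baire_rep
    (closed_choice baire_rep).
Proof.
move=> [B [p0 [_ [m hm]] hB] graph].
have {}hm p : Phi m p p0 by exact: hm.
pose viol u := (exists i j, far alphaY ((evens (odds u) i, evens (odds u) j), (i, j)))
  \/ hits (p0 0) (bpair (evens (evens u))
       (bpair (bpair (odds (evens u)) (drop_first (evens (odds u)))) (odds (odds u)))).
have re := reads_evens reads_id; have ro := reads_odds reads_id.
have rq := reads_evens ro.
have sv : semidec (fun (_ : unit) u => viol u).
  exact: (semidec_or (semidec_far_reads hY rq rq)
    (semidec_hits_const (p0 0) (reads_bpair (reads_evens re) (reads_bpair
      (reads_bpair (reads_odds re) (reads_shift rq)) (reads_odds ro))))).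
have [n hn] := semidec_closed sv.
(* The parameter [u] of [viol] pairs the tail of [h p] with a candidate [s]. *)
pose A p : set baire := [set s | ~ viol (bpair (bpair (drop_first p0) p) s)].
pose h p := prepend n (bpair (drop_first p0) p).
have hA p : closed_rep baire_rep (h p) (A p) by apply: hn => r s <-.
have AP p s x y : dX p x -> dY (drop_first (evens s)) y ->
    A p s <-> near_cauchy alphaY (evens s) /\ B ((x, y), odds s).
  move=> px py.
  have hb : prod_rep (prod_rep dX dY) baire_rep
      (bpair (bpair p (drop_first (evens s))) (odds s)) ((x, y), odds s).
    exists (bpair p (drop_first (evens s))), (odds s); split=> //.
    by exists p, (drop_first (evens s)).
  have eB := closed_repE hB hb; have eN := far_near_cauchy alphaY (evens s).
  rewrite /A /viol /= !(odds_bpair, evens_bpair).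
  split=> [nv|[/eN far_free /eB hit_free] [c|c]] //.
  by split; [apply/eN => c|apply/eB => c]; apply: nv; [left|right].
have cH : computable (fun p => [set h p]).
  split; first by move=> p q q' -> ->.
  have [|||e he] := @computable_subst m p0 (fun x => if x.1 == 0 then n else
    if odd x.1.-1 then x.2.1 else x.2.2) (fun i => i.-1./2) (fun i => i.-1./2.+1) hm.
  - by prs.
  - by prs.
  - by prs.
  exists e => p q ->; have := he p.
  by rewrite (_ : (fun i => _) = h p) //; apply/funext => -[|i].
have cK : computable (fun t => [set drop_first (evens (odds t))]).
  split; first by move=> p q q' -> ->.
  have [phi pphi ephi] := reads_shift rq.
  have [|||e he] := @computable_subst m p0 (fun x => x.2.1) phi (fun=> 0) hm.
  - by prs.
  - by prs.
  - by prs.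
  exists e => p q ->; have := he p.
  by rewrite (_ : (fun i => _) = drop_first (evens (odds p))) //; apply/funext.
exists (fun t => [set drop_first (evens (odds t))]), (fun p => [set h p]); split=> //.
move=> G [sG hG]; split=> [p q q'|p x px _].
  move=> [_ [s [-> Gs ->]]] [_ [s' [-> Gs' ->]]].
  by rewrite !odds_bpair (sG _ _ _ Gs Gs').
have [s0 s0P] : closed_choice baire_rep (A p) !=set0.
  have [q hq] := name_exists (f x) (alpha_dense hY).
  have hq' := near_name_shift (cauchy_rep_near hq).
  have [r Br] : exists r, B ((x, f x), r) by apply/graph.
  exists (bpair q r); split.
    by apply: (semidec_rep_closed (q := bpair (drop_first p0) p) sv) => s.
  apply/(AP _ _ x (f x)); rewrite ?evens_bpair ?odds_bpair //.
  by split=> //; exact: cauchy_rep_near_cauchy hq.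
have [s [_ [Gs -> [_ As]]]] := hG (h p) (A p) (hA p) (ex_intro _ s0 s0P).
have nc : near_cauchy alphaY (evens s).
  apply/far_near_cauchy => c; apply: As; left.
  by rewrite odds_bpair.
have [y hy] := near_cauchy_shift hY nc.
have [_ Bs] : near_cauchy alphaY (evens s) /\ B ((x, y), odds s) by apply/(AP p).
exists (drop_first (evens s)), y; split=> //; last first.
  by apply/(graph (x, y)); exists (odds s).
by exists (h p), s; split=> //; rewrite odds_bpair.
Qed.

End Directions.

Theorem theorem7p7 (R : realType) (X Y : metricType R)
    (alphaX : nat -> X) (alphaY : nat -> Y)
    (hX : computable_polish alphaX) (hY : computable_polish alphaY)
    (f : X -> Y) :
  weihrauch_le (cauchy_rep alphaX) (cauchy_rep alphaY) (mfun_of f)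
    (closed_rep baire_rep) baire_rep (closed_choice baire_rep)
  <->
  effectively_Borel (cauchy_rep alphaX) (cauchy_rep alphaY) f.
Proof.
by split; [exact: borel_of_weihrauch|exact: weihrauch_of_borel].
Qed.
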